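(* Let $(M,G=g+F)$ be a generalized Riemannian manifold, let $A$ be the $(1,1)$-tensor with $F(X,Y)=g(AX,Y)$, and let $\nabla^g$ be the Levi-Civita connection of $g$. Let $\nabla$ be a linear connection on $M$ with torsion $T$, and let $\nabla g$ be the covariant derivative of $g$. Then $\nabla$ is uniquely determined by the formula $$g(\nabla_XY,Z)=g(\nabla^g_XY,Z)+\tfrac12\big[T(X,Y,Z)+T(Z,X,Y)-T(Y,Z,X)\big]-\tfrac12\big[(\nabla_Xg)(Y,Z)+(\nabla_Yg)(Z,X)-(\nabla_Zg)(Y,X)\big].\quad (1)$$ The covariant derivative $\nabla F$ is given by $$\begin{aligned}(\nabla_XF)(Y,Z)={}&(\nabla^g_XF)(Y,Z)+\tfrac12\big[T(X,Y,AZ)+T(Z,X,AY)\big]\\&+\tfrac12\big[T(AZ,X,Y)+T(AZ,Y,X)+T(X,AY,Z)+T(Z,AY,X)\big]\\&+\tfrac12\big[(\nabla_Xg)(AY,Z)-(\nabla_Xg)(Y,AZ)-(\nabla_Yg)(AZ,X)\big]\\&+\tfrac12\big[(\nabla_Zg)(AY,X)+(\nabla_{AZ}g)(Y,X)-(\nabla_{AY}g)(Z,X)\big].\end{aligned}\quad (2)$$ In particular, $$dF(X,Y,Z)=-T(X,Y,AZ)-T(Y,Z,AX)-T(Z,X,AY)+(\nabla_XF)(Y,Z)+(\nabla_YF)(Z,X)+(\nabla_ZF)(X,Y).$$ Conversely, let $T$, $Q$, $P$ be any three $(0,3)$-tensors, with $T$ skew-symmetric in its first two arguments, $Q$ symmetric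 in its last two arguments and $P$ skew-symmetric in its last two arguments, such that (2) holds with $(\nabla_Xg)(Y,Z)$ replaced by $Q(X,Y,Z)$ and $(\nabla_XF)(Y,Z)$ replaced by $P(X,Y,Z)$. Then they determine a unique linear connection $\nabla$ with torsion $T$, $(\nabla_Xg)(Y,Z)=Q(X,Y,Z)$ and $(\nabla_XF)(Y,Z)=P(X,Y,Z)$, namely the one given by (1) with $Q$ in place of $\nabla g$.
   Context: A generalized (non-symmetric) Riemannian manifold $(M,G)$ is a smooth manifold with a smooth $(0,2)$-tensor $G=g+F$, where $g(X,Y)=\frac12(G(X,Y)+G(Y,X))$ is the symmetric part, assumed non-degenerate (of arbitrary signature), and $F(X,Y)=\frac12(G(X,Y)-G(Y,X))$ is the skew-symmetric part. The $(1,1)$-tensor $A$ is defined by $F(X,Y)=g(AX,Y)$. The torsion of $\nabla$ is $T(X,Y)=\nabla_XY-\nabla_YX-[X,Y]$, and its $(0,3)$-version is $T(X,Y,Z)=g(T(X,Y),Z)$. The exterior derivative is normalized so that for commuting vector fields $dF(X,Y,Z)=XF(Y,Z)+YF(Z,X)+ZF(X,Y)$. Tensor identities hold for all vector fields $X,Y,Z$. *)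

(* Defs.v *)
From HB Require Import structures.
From mathcomp Require Import all_boot all_order all_algebra.
From mathcomp Require Import all_classical all_reals all_analysis.
From mathcomp Require Import ring.

Set Implicit Arguments.
Unset Strict Implicit.
Unset Printing Implicit Defensive.

Import Order.TTheory GRing.Theory Num.Theory.
Import numFieldNormedType.Exports.

Local Open Scope classical_set_scope.
Local Open Scope ring_scope.

Section SmoothOnOpen.
Context {R : realType} {n : nat}.
Implicit Types (U : set 'rV[R]_n) (f g : 'rV[R]_n -> R).

(* Meaningful for open [U]: [f] is of class C^k on [U]. *)
Fixpoint Ck (k : nat) U f : Prop :=
  (forall x, U x -> {for x, continuous f}) /\
  if k is k'.+1 then
    forall i : 'I_n,
      (forall x, U x -> derivable f x (delta_mx 0 i)) /\
      Ck k' U (fun x => 'D_(delta_mx 0 i) f x)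
  else True.

Definition smooth_on U f := forall k, Ck k U f.

Lemma Ck_continuous k U f : Ck k U f -> forall x, U x -> {for x, continuous f}.
Proof. by case: k => [|k] []. Qed.

Lemma Ck_pred k U f : Ck k.+1 U f -> Ck k U f.
Proof.
elim: k f => [|k IH] f [fc fd]; split => // i; have [fi fki] := fd i.
by split => //; exact: IH.
Qed.

Lemma Ck_eq k U f g : open U -> (forall x, U x -> f x = g x) ->
  Ck k U f -> Ck k U g.
Proof.
move=> oU; have nU x : U x -> \forall y \near x, U y.
  by move=> Ux; exact: open_nbhs_nbhs.
elim: k f g => [|k IH] f g fg /= [fc fd].
  split => // x Ux.
  have fgx : \forall y \near x, f y = g y by apply: filterS (nU x Ux).
  rewrite /prop_for /continuous_at -(fg x Ux).
  exact: cvg_trans (near_eq_cvg fgx) (fc x Ux).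
split=> [x Ux|i].
  have fgx : \forall y \near x, f y = g y by apply: filterS (nU x Ux).
  rewrite /prop_for /continuous_at -(fg x Ux).
  exact: cvg_trans (near_eq_cvg fgx) (fc x Ux).
have [fi fki] := fd i; split=> [x Ux|].
  have fgx : \forall y \near x, f y = g y by apply: filterS (nU x Ux).
  exact: near_eq_derivable fgx (fi x Ux).
apply: IH fki => x Ux; apply: near_eq_derive.
by apply: filterS (nU x Ux).
Qed.

Lemma Ck_cst k U (a : R) : Ck k U (cst a).
Proof.
elim: k a => [|k IH] a /=.
  by split => // x _; exact: cst_continuous.
split=> [x _|i]; first exact: cst_continuous.
split=> [x _|]; first exact: derivable_cst.
rewrite (_ : (fun _ => _) = cst 0); first exact: IH.
by apply/funext => x /=; rewrite derive_cst.
Qed.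

Lemma CkD k U f g : open U -> Ck k U f -> Ck k U g -> Ck k U (f + g).
Proof.
move=> oU; elim: k f g => [|k IH] f g [fc fd] [gc gd] /=.
  by split=> // x Ux; apply: continuousD; [exact: fc|exact: gc].
split=> [x Ux|i]; first by apply: continuousD; [exact: fc|exact: gc].
have [fi fki] := fd i; have [gi gki] := gd i; split=> [x Ux|].
  by apply: derivableD; [exact: fi|exact: gi].
apply: Ck_eq (IH _ _ fki gki) => // x Ux.
by rewrite deriveD; [|exact: fi|exact: gi].
Qed.

Lemma CkM k U f g : open U -> Ck k U f -> Ck k U g -> Ck k U (f * g).
Proof.
move=> oU; elim: k f g => [|k IH] f g Hf Hg.
  by split=> // x Ux; apply: continuousM;
    [exact: Ck_continuous Hf _ Ux|exact: Ck_continuous Hg _ Ux].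
have [_ fd] := Hf; have [_ gd] := Hg.
split=> [x Ux|i].
  by apply: continuousM;
    [exact: Ck_continuous Hf _ Ux|exact: Ck_continuous Hg _ Ux].
have [fi fki] := fd i; have [gi gki] := gd i; split=> [x Ux|].
  by apply: derivableM; [exact: fi|exact: gi].
apply: (Ck_eq oU _ (CkD oU (IH _ _ (Ck_pred Hf) gki)
                           (IH _ _ (Ck_pred Hg) fki))) => x Ux.
by rewrite deriveM; [|exact: fi|exact: gi].
Qed.

End SmoothOnOpen.

(* [chart_map] and [chart_inv] are total functions whose values matter only on
   [chart_dom] and on its image. *)
Record chart (R : realType) (n : nat) (M : topologicalType) := Chart {
  chart_dom : set M;
  chart_map : M -> 'rV[R]_n;
  chart_inv : 'rV[R]_n -> M;
  chart_dom_open : open chart_dom;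
  chart_img_open : open (chart_map @` chart_dom);
  chart_mapK : forall p, chart_dom p -> chart_inv (chart_map p) = p;
  chart_map_cont : forall p, chart_dom p -> {for p, continuous chart_map};
  chart_inv_cont :
    forall x, (chart_map @` chart_dom) x -> {for x, continuous chart_inv}
}.

(* The atlas need not be maximal: it determines its maximal atlas, and the
   smooth functions are the same for both. *)
Record manifold (R : realType) (n : nat) := Manifold {
  points :> topologicalType;
  manifold_hausdorff : hausdorff_space points;
  manifold_countable : @second_countable points;
  atlas : set (chart R n points);
  atlas_cover : forall p : points, exists2 c, atlas c & chart_dom c p;
  atlas_compat : forall c1 c2, atlas c1 -> atlas c2 -> forall j : 'I_n,
    smooth_on (chart_map c1 @` (chart_dom c1 `&` chart_dom c2))
              (fun x => chart_map c2 (chart_inv c1 x) 0 j)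
}.

Section SmoothFunctions.
Context {R : realType} {n : nat} (M : manifold R n).

Definition smooth (f : M -> R) : Prop := forall c, atlas c ->
  smooth_on (chart_map c @` chart_dom c) (f \o chart_inv c).

Definition smooth_pred : {pred M -> R} := [pred f | `[< smooth f >]].

Lemma smooth_cst (a : R) : smooth (cst a).
Proof. by move=> c _ k; exact: Ck_cst. Qed.

Lemma smoothD f g : smooth f -> smooth g -> smooth (f + g).
Proof.
move=> sf sg c ac k.
have := CkD (@chart_img_open _ _ _ c) (sf c ac k) (sg c ac k); exact.
Qed.

Lemma smoothM f g : smooth f -> smooth g -> smooth (f * g).
Proof.
move=> sf sg c ac k.
have := CkM (@chart_img_open _ _ _ c) (sf c ac k) (sg c ac k); exact.
Qed.

Lemma smoothZ (a : R) f : smooth f -> smooth (a *: f).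
Proof. by move=> sf; exact: smoothM (smooth_cst a) sf. Qed.

Lemma smoothN f : smooth f -> smooth (- f).
Proof. by move=> sf; rewrite -scaleN1r; exact: smoothZ. Qed.

Lemma smooth_subring_closed : subring_closed smooth_pred.
Proof.
split=> [|f g|f g]; rewrite !inE /=.
- exact: (smooth_cst 1).
- by move=> sf sg; apply: smoothD => //; exact: smoothN.
- by move=> sf sg; apply: smoothM.
Qed.

Lemma smooth_scaler_closed : GRing.scaler_closed smooth_pred.
Proof.
by move=> a f; rewrite !inE /= => sf; exact: smoothZ.
Qed.

HB.instance Definition _ :=
  GRing.isSubringClosed.Build _ smooth_pred smooth_subring_closed.
HB.instance Definition _ :=
  GRing.isScaleClosed.Build _ _ smooth_pred smooth_scaler_closed.

Record Cinf := MkCinf { cinf_fun :> M -> R; _ : cinf_fun \in smooth_pred }.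

HB.instance Definition _ := [isSub for cinf_fun].
HB.instance Definition _ := [Choice of Cinf by <:].
HB.instance Definition _ :=
  GRing.SubChoice_isSubComPzRing.Build _ _ Cinf (GRing.subringClosedP _).
HB.instance Definition _ :=
  GRing.SubZmodule_isSubLmodule.Build _ _ _ Cinf (GRing.subsemimodClosedP _).

Definition to_Cinf (f : M -> R) (sf : smooth f) : Cinf :=
  MkCinf (asboolT sf).

Lemma Cinf_smooth (f : Cinf) : smooth f.
Proof. by case: f => f /= sf; exact: asboolW sf. Qed.

End SmoothFunctions.

Section TangentVectors.
Context {R : realType} {n : nat} (M : manifold R n) (p : M).

Definition derivation_at (v : Cinf M -> R) : Prop :=
  scalar v /\ forall f g : Cinf M, v (f * g) = v f * g p + f p * v g.

Definition derivation_pred : {pred Cinf M -> R} :=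
  [pred v | `[< derivation_at v >]].

Lemma derivation_submod_closed : submod_closed derivation_pred.
Proof.
split=> [|a u v]; rewrite !inE /=.
  by split=> [a f g|f g] /=; rewrite ?mulr0 ?mul0r ?addr0.
move=> [ul uM] [vl vM]; split=> [b f g|f g].
  rewrite /= !fctE ul vl !scalerDr mulrDr addrACA; congr (_ + _).
  by congr (_ + _); rewrite /GRing.scale/= mulrCA.
by rewrite !fctE uM vM /GRing.scale/= !mulrDr !mulrDl addrACA !mulrA
           [a * f p]mulrC.
Qed.

HB.instance Definition _ :=
  GRing.isSubmodClosed.Build _ _ derivation_pred derivation_submod_closed.

Record tangent :=
  MkTangent { tangent_fun :> Cinf M -> R; _ : tangent_fun \in derivation_pred }.

HB.instance Definition _ := [isSub for tangent_fun].
HB.instance Definition _ := [Choice of tangent by <:].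
HB.instance Definition _ :=
  GRing.SubChoice_isSubLmodule.Build _ _ _ tangent (GRing.subsemimodClosedP _).

Definition to_tangent v (dv : derivation_at v) : tangent :=
  MkTangent (asboolT dv).

Lemma tangentP (v : tangent) : derivation_at v.
Proof. by case: v => v /= dv; exact: asboolW dv. Qed.

Lemma tangent_ext (u v : tangent) : (forall f, u f = v f) -> u = v.
Proof. by move=> uv; apply/val_inj/funext. Qed.

End TangentVectors.

Section VectorFields.
Context {R : realType} {n : nat} (M : manifold R n).

Record vfield := VField {
  vfield_at :> forall p : M, tangent p;
  vfield_smooth : forall f : Cinf M, smooth (fun p => vfield_at p f)
}.

Implicit Types (X Y Z : vfield) (f : Cinf M).

Definition lie X f : Cinf M := to_Cinf (vfield_smooth X f).

Lemma vfield_ext X Y : (forall p, X p = Y p) -> X = Y.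
Proof.
case: X Y => [X sX] [Y sY] /= XY.
have {}XY : X = Y by exact: functional_extensionality_dep.
by rewrite XY in sX *; congr VField; exact: Prop_irrelevance.
Qed.

Fact vfield_add_smooth X Y f : smooth (fun p => (X p + Y p) f).
Proof. exact: Cinf_smooth (lie X f + lie Y f). Qed.
Definition vfield_add X Y := VField (vfield_add_smooth X Y).

Fact vfield_opp_smooth X f : smooth (fun p => (- X p) f).
Proof. exact: Cinf_smooth (- lie X f). Qed.
Definition vfield_opp X := VField (vfield_opp_smooth X).

Fact vfield_zero_smooth f : smooth (fun p => (0 : tangent p) f).
Proof. exact: smooth_cst. Qed.
Definition vfield_zero := VField vfield_zero_smooth.

Fact vfield_scale_smooth (h : Cinf M) X f : smooth (fun p => (h p *: X p) f).
Proof. exact: Cinf_smooth (h * lie X f). Qed.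
Definition vfield_scale h X := VField (vfield_scale_smooth h X).

HB.instance Definition _ := gen_eqMixin vfield.
HB.instance Definition _ := gen_choiceMixin vfield.

Fact vfield_addA : associative vfield_add.
Proof. by move=> X Y Z; apply: vfield_ext => p /=; rewrite addrA. Qed.
Fact vfield_addC : commutative vfield_add.
Proof. by move=> X Y; apply: vfield_ext => p /=; rewrite addrC. Qed.
Fact vfield_add0 : left_id vfield_zero vfield_add.
Proof. by move=> X; apply: vfield_ext => p /=; rewrite add0r. Qed.
Fact vfield_addN : left_inverse vfield_zero vfield_opp vfield_add.
Proof. by move=> X; apply: vfield_ext => p /=; rewrite addNr. Qed.

HB.instance Definition _ := GRing.isZmodule.Build vfield
  vfield_addA vfield_addC vfield_add0 vfield_addN.

Fact vfield_scaleA (a b : Cinf M) X :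
  vfield_scale a (vfield_scale b X) = vfield_scale (a * b) X.
Proof. by apply: vfield_ext => p /=; rewrite scalerA. Qed.
Fact vfield_scale1 : left_id 1 vfield_scale.
Proof. by move=> X; apply: vfield_ext => p /=; rewrite scale1r. Qed.
Fact vfield_scaleDr : right_distributive vfield_scale +%R.
Proof. by move=> a X Y; apply: vfield_ext => p /=; rewrite scalerDr. Qed.
Fact vfield_scaleDl X : {morph vfield_scale^~ X : a b / a + b}.
Proof. by move=> a b; apply: vfield_ext => p /=; rewrite scalerDl. Qed.

HB.instance Definition _ := GRing.Zmodule_isLmodule.Build (Cinf M) vfield
  vfield_scaleA vfield_scale1 vfield_scaleDr vfield_scaleDl.

Lemma lie_linear X (a : R) f g : lie X (a *: f + g) = a *: lie X f + lie X g.
Proof. by apply/val_inj/funext => p /=; rewrite (tangentP (X p)).1. Qed.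

Lemma lieM X f g : lie X (f * g) = lie X f * g + f * lie X g.
Proof. by apply/val_inj/funext => p /=; rewrite (tangentP (X p)).2. Qed.

Fact bracket_derivation X Y p :
  derivation_at p (fun f => X p (lie Y f) - Y p (lie X f)).
Proof.
have [Xl XM] := tangentP (X p); have [Yl YM] := tangentP (Y p).
split=> [a f g|f g].
  by rewrite !lie_linear Xl Yl opprD addrACA -mulrBr.
have XD u v : X p (u + v) = X p u + X p v.
  by rewrite -[u]scale1r Xl mul1r scale1r.
have YD u v : Y p (u + v) = Y p u + Y p v.
  by rewrite -[u]scale1r Yl mul1r scale1r.
rewrite !lieM XD YD !XM !YM /=; ring.
Qed.

Fact bracket_smooth X Y f : smooth (fun p => to_tangent (bracket_derivation X Y p) f).
Proof. exact: Cinf_smooth (lie X (lie Y f) - lie Y (lie X f)). Qed.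
Definition bracket X Y : vfield := VField (bracket_smooth X Y).

End VectorFields.

Section Tensors.
Context {R : realType} {n : nat} (M : manifold R n).

(* Smooth tensor fields are smooth families of multilinear maps on the tangent
   spaces; smoothness is tested on smooth vector fields. *)
Record tensor11 := Tensor11 {
  tensor11_at :> forall p : M, tangent p -> tangent p;
  tensor11_linear : forall p, linear (@tensor11_at p);
  tensor11_smooth : forall (X : vfield M) (f : Cinf M),
    smooth (fun p => tensor11_at (X p) f)
}.

Record tensor02 := Tensor02 {
  tensor02_at :> forall p : M, tangent p -> tangent p -> R;
  tensor02_linearl : forall p (v : tangent p),
    scalar (fun u : tangent p => tensor02_at u v);
  tensor02_linearr : forall p (u : tangent p), scalar (tensor02_at u);
  tensor02_smooth : forall X Y : vfield M,
    smooth (fun p => tensor02_at (X p) (Y p))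
}.

Record tensor03 := Tensor03 {
  tensor03_at :> forall p : M, tangent p -> tangent p -> tangent p -> R;
  tensor03_linear1 : forall p (v w : tangent p),
    scalar (fun u : tangent p => tensor03_at u v w);
  tensor03_linear2 : forall p (u w : tangent p),
    scalar (fun v : tangent p => tensor03_at u v w);
  tensor03_linear3 : forall p (u v : tangent p), scalar (tensor03_at u v);
  tensor03_smooth : forall X Y Z : vfield M,
    smooth (fun p => tensor03_at (X p) (Y p) (Z p))
}.

Definition ev11 (A : tensor11) (X : vfield M) : vfield M :=
  VField (tensor11_smooth A X).

Definition ev02 (B : tensor02) (X Y : vfield M) : Cinf M :=
  to_Cinf (tensor02_smooth B X Y).

Definition ev03 (B : tensor03) (X Y Z : vfield M) : Cinf M :=
  to_Cinf (tensor03_smooth B X Y Z).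

Section Parts.
Variable B : tensor02.

Let sym p (u v : tangent p) : R := 2^-1 * (B p u v + B p v u).
Let skew p (u v : tangent p) : R := 2^-1 * (B p u v - B p v u).

Fact sym_linearl p (v : tangent p) : scalar (fun u : tangent p => sym u v).
Proof.
move=> a u w; rewrite /sym (tensor02_linearl B v) (tensor02_linearr B v); ring.
Qed.
Fact sym_linearr p (u : tangent p) : scalar (sym u).
Proof.
move=> a v w; rewrite /sym (tensor02_linearl B u) (tensor02_linearr B u); ring.
Qed.
Fact sym_smooth (X Y : vfield M) : smooth (fun p => sym (X p) (Y p)).
Proof. exact: Cinf_smooth (2^-1 *: (ev02 B X Y + ev02 B Y X)). Qed.
Definition sym_part := Tensor02 sym_linearl sym_linearr sym_smooth.

Fact skew_linearl p (v : tangent p) : scalar (fun u : tangent p => skew u v).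
Proof.
move=> a u w; rewrite /skew (tensor02_linearl B v) (tensor02_linearr B v); ring.
Qed.
Fact skew_linearr p (u : tangent p) : scalar (skew u).
Proof.
move=> a v w; rewrite /skew (tensor02_linearl B u) (tensor02_linearr B u); ring.
Qed.
Fact skew_smooth (X Y : vfield M) : smooth (fun p => skew (X p) (Y p)).
Proof. exact: Cinf_smooth (2^-1 *: (ev02 B X Y - ev02 B Y X)). Qed.
Definition skew_part := Tensor02 skew_linearl skew_linearr skew_smooth.

End Parts.

Definition nondegenerate (B : tensor02) : Prop :=
  forall (p : M) (u : tangent p), (forall v : tangent p, B p u v = 0) -> u = 0.

Definition generalized_riemannian (G : tensor02) : Prop :=
  nondegenerate (sym_part G).

(* normalized without the factor 1/3 *)
Definition dext (F : tensor02) (X Y Z : vfield M) : Cinf M :=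
  lie X (ev02 F Y Z) + lie Y (ev02 F Z X) + lie Z (ev02 F X Y)
  - ev02 F (bracket X Y) Z - ev02 F (bracket Y Z) X - ev02 F (bracket Z X) Y.

End Tensors.

Section Connections.
Context {R : realType} {n : nat} (M : manifold R n).

Record connection := Connection {
  nabla :> vfield M -> vfield M -> vfield M;
  nabla_linearl : forall Y, linear (fun X => nabla X Y);
  nabla_additive : forall X Y Z, nabla X (Y + Z) = nabla X Y + nabla X Z;
  nabla_leibniz : forall X (f : Cinf M) Y,
    nabla X (f *: Y) = lie X f *: Y + f *: nabla X Y
}.

Implicit Types (D : connection) (B g F : tensor02 M) (X Y Z : vfield M).

Definition torsion D X Y : vfield M := D X Y - D Y X - bracket X Y.

(* T(X, Y, Z) = g(T(X, Y), Z) *)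
Definition torsion03 g D X Y Z : Cinf M := ev02 g (torsion D X Y) Z.

(* (nabla_X B)(Y, Z) *)
Definition covd D B X Y Z : Cinf M :=
  lie X (ev02 B Y Z) - ev02 B (D X Y) Z - ev02 B Y (D X Z).

Definition levi_civita g D : Prop :=
  (forall X Y, torsion D X Y = 0) /\ (forall X Y Z, covd D g X Y Z = 0).

(* The right-hand sides below take arbitrary T and Q: these are the torsion and
   nabla g of a connection, or prescribed (0,3)-tensors. *)
Implicit Types T Q : vfield M -> vfield M -> vfield M -> Cinf M.

(* g(nabla_X Y, Z) in terms of T and Q = nabla g; [LC] is the Levi-Civita
   connection of [g] *)
Definition conn_rhs g LC T Q X Y Z : Cinf M :=
  ev02 g (nabla LC X Y) Z
  + 2^-1 *: (T X Y Z + T Z X Y - T Y Z X)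
  - 2^-1 *: (Q X Y Z + Q Y Z X - Q Z Y X).

Definition conn_given_by g LC T Q D : Prop :=
  forall X Y Z, ev02 g (D X Y) Z = conn_rhs g LC T Q X Y Z.

(* (nabla_X F)(Y, Z) in terms of T and Q = nabla g *)
Definition nablaF_rhs F (A : tensor11 M) LC T Q X Y Z : Cinf M :=
  let A := ev11 A in
  covd LC F X Y Z
  + 2^-1 *: (T X Y (A Z) + T Z X (A Y))
  + 2^-1 *: (T (A Z) X Y + T (A Z) Y X + T X (A Y) Z + T Z (A Y) X)
  + 2^-1 *: (Q X (A Y) Z - Q X Y (A Z) - Q Y (A Z) X)
  + 2^-1 *: (Q Z (A Y) X + Q (A Z) Y X - Q (A Y) Z X).

End Connections.

(* Main.v *)
From HB Require Import structures.
From mathcomp Require Import all_boot all_order all_algebra.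
From mathcomp Require Import all_classical all_reals all_analysis.
From mathcomp Require Import ring lra.
Require Import Defs.

Set Implicit Arguments.
Unset Strict Implicit.
Unset Printing Implicit Defensive.

Import Order.TTheory GRing.Theory Num.Theory.
Import numFieldNormedType.Exports.

Local Open Scope classical_set_scope.
Local Open Scope ring_scope.

(** Everything is controlled by the difference tensor S(X,Y) = nabla_X Y -
    nabla^g_X Y.  As nabla^g is torsion-free and metric, with
    s(X,Y,Z) = g(S(X,Y),Z) one has
      T(X,Y,Z) = s(X,Y,Z) - s(Y,X,Z),
      (nabla_X g)(Y,Z) = - s(X,Y,Z) - s(X,Z,Y),
      (nabla_X F)(Y,Z) - (nabla^g_X F)(Y,Z) = s(X,Y,AZ) - s(X,Z,AY).
    Solving the first two equations for s, as in the Koszul formula, gives the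
    formula for nabla; substituting the solution into the third one gives the
    formula for nabla F; the formula for dF is the cyclic sum of the definition
    of nabla F.  Conversely, given T and Q, one defines s by the solved formula,
    takes S to be its g-dual and puts nabla = nabla^g + S.  The symmetries of T
    and Q make them the torsion and the derivative of g, and the formula for
    nabla F, which then holds for nabla, identifies nabla F with P.

    The analytic content is in two facts used freely on paper: a vector field W
    with g(W,Z) = 0 for every vector field Z vanishes ([nondegenerate_vfield]),
    and every smooth family of linear forms on the tangent spaces is g-dual to a
    smooth vector field ([metric_dual]).  Tangent vectors are derivations of the
    algebra of global smooth functions, and nondegeneracy is a condition on each
    tangent space, so one needs tangent spaces to be finite dimensional and to be
    spanned by the values of global vector fields; this is [local_frame].
    It comes from Hadamard's lemma: near q,
      f = f(q) + sum_j (x_j - x_j(q)) h_j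
    with h_j smooth ([hadamard], [Ck_segint]).  Multiplying by bump functions
    makes all the terms global, and a derivation v at q then gives
    v f = sum_j v(x_j) (d_j f)(q) ([local_coordinates]).  Bump functions are
    built from exp(-1/t) ([bump]), and the smoothness of coordinate expressions
    in other charts is the chain rule ([Ck_comp]).  A frame turns g into an
    invertible Gram matrix, and duals are smooth by Cramer's rule. *)

(** * Differentials and the chain rule in coordinates *)

Section ChainRule.
Context {R : realType}.

Lemma is_derive_along (V : normedModType R) (f : V -> R) (z v : V) (s : R) :
  derivable f (s *: v + z) v ->
  is_derive s (1 : R) (fun t : R => f (t *: v + z)) ('D_v f (s *: v + z)).
Proof.
have E : (fun h : R => h^-1 *: (f ((h *: (1 : R) + s) *: v + z) - f (s *: v + z)))
       = (fun h => h^-1 *: (f (h *: v + (s *: v + z)) - f (s *: v + z))).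
  by apply/funext => h; rewrite [h *: (1 : R)]mulr1 scalerDl addrA.
by move=> df; apply: DeriveDef; rewrite /derivable /derive /= E.
Qed.

Lemma derive_line (V W : normedModType R) (f : V -> W) (x v : V) :
  'D_v f x = 'D_1 (fun h : R => f (h *: v + x)) 0.
Proof.
rewrite /derive; apply: congr1; rewrite -/(f _).
suff -> : (fun h : R => h^-1 *: (f ((h *: (1 : R) + 0) *: v + x)
    - f ((0 : R) *: v + x))) = (fun h => h^-1 *: (f (h *: v + x) - f x)) by [].
by apply/funext => h; rewrite addr0 scale0r add0r [h *: (1 : R)]mulr1.
Qed.

(** Both signs of [b] are covered, so that increments along an edge of a
    coordinate path need no case analysis. *)
Lemma MVT_unordered (f df : R -> R) (b : R) :
  (forall s, `|s| <= `|b| -> 0 <= s * b -> is_derive s (1 : R) f (df s)) ->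
  exists s, [/\ `|s| <= `|b|, 0 <= s * b & f b - f 0 = df s * b].
Proof.
move=> fdf; have [b0|b0] := leP 0 b.
  have dfi s : s \in `[0, b] -> is_derive s (1 : R) f (df s).
    rewrite in_itv/= => /andP[s0 sb]; apply: fdf; last exact: mulr_ge0.
    by rewrite !ger0_norm.
  have dfo s : s \in `]0, b[ -> is_derive s (1 : R) f (df s).
    by rewrite in_itv/= => /andP[/ltW s0 /ltW sb]; apply: dfi; rewrite in_itv/= s0.
  have fc : {within `[0, b], continuous f}.
    by apply: derivable_within_continuous => s sb; have ? := dfi s sb;
      exact: ex_derive.
  have [c] := MVT_segment b0 dfo fc.
  rewrite in_itv/= subr0 => /andP[c0 cb] ->; exists c.
  by split => //; [rewrite !ger0_norm|exact: mulr_ge0].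
have b0' := ltW b0.
have dfi s : s \in `[b, 0] -> is_derive s (1 : R) f (df s).
  rewrite in_itv/= => /andP[s0 sb]; apply: fdf; last exact: mulr_le0.
  by rewrite !ler0_norm ?lerN2.
have dfo s : s \in `]b, 0[ -> is_derive s (1 : R) f (df s).
  by rewrite in_itv/= => /andP[/ltW s0 /ltW sb]; apply: dfi; rewrite in_itv/= s0.
have fc : {within `[b, 0], continuous f}.
  by apply: derivable_within_continuous => s sb; have ? := dfi s sb;
    exact: ex_derive.
have [c] := MVT_segment (ltW b0) dfo fc.
rewrite in_itv/= sub0r => /andP[c0 cb] E; exists c; split.
- by rewrite !ler0_norm ?lerN2.
- exact: mulr_le0.
- by rewrite -[LHS]opprK opprB E mulrN opprK.
Qed.

Context {n : nat}.
Implicit Types (U : set 'rV[R]_n) (f : 'rV[R]_n -> R) (x y : 'rV[R]_n).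

Local Notation e_ i := (delta_mx 0 i : 'rV[R]_n).

Lemma ball_rVP x (d : R) y : 0 < d ->
  ball x d y <-> forall j, `|x 0 j - y 0 j| < d.
Proof.
move=> d0; split=> [[_ H] j|H]; first exact: H.
by split=> // i j; rewrite (ord1 i); exact: H.
Qed.

Let step (k : nat) x y : 'rV[R]_n := \row_j (if (j < k)%N then y 0 j else x 0 j).

(** The increment of [f] is split along the path from [x] to [y] that changes
    one coordinate at a time; the mean value theorem applies on each edge, and
    the path stays in the ball because the norm is the sup norm. *)
Lemma C1_increment U f x (eps : R) : open U -> Ck 1 U f -> U x -> 0 < eps ->
  \forall y \near x,
    `|f y - f x - \sum_j (y - x) 0 j * 'D_(e_ j) f x| <= eps * `|y - x|.
Proof.
move=> oU [_ /= fd] Ux eps0.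
have n1 : 0 < n.+1%:R :> R by rewrite ltr0n.
(* The n edges share the error; n.+1 avoids a division by zero when n = 0. *)
pose e' := eps / n.+1%:R; have e'0 : 0 < e' by rewrite divr_gt0.
have nearD : \forall y \near x,
    U y /\ forall j, `|'D_(e_ j) f x - 'D_(e_ j) f y| < e'.
  near=> y; split; first by near: y; exact: open_nbhs_nbhs.
  near: y; apply: filter_forall => j.
  have [_ [dc _]] := fd j.
  exact: ((cvgrPdist_lt _ _).1 (dc x Ux) _ e'0).
have /nbhs_ballP[d d0 dP] := nearD.
apply/nbhs_ballP; exists d => // y; rewrite ball_rVP// => xy.
have stepB k : ball x d (step k x y).
  by rewrite ball_rVP// => j; rewrite mxE; case: ifP => // _; rewrite subrr normr0.
have stepE (k : 'I_n) : step k.+1 x y = (y - x) 0 k *: e_ k + step k x y.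
  apply/rowP => j; rewrite !mxE eqxx ltnS /= leq_eqVlt.
  case: (eqVneq j k) => [->|jk]; first by rewrite eqxx ltnn mulr1 subrK.
  have -> : (j == k :> nat) = false by apply/negbTE.
  by rewrite mulr0 add0r.
have tele : f y - f x = \sum_(k < n) (f (step k.+1 x y) - f (step k x y)).
  rewrite -(big_mkord xpredT (fun k => f (step k.+1 x y) - f (step k x y))).
  rewrite telescope_sumr//; congr (f _ - f _); apply/rowP => j; rewrite mxE.
    by rewrite ltn_ord.
  by rewrite ltn0.
have edge (k : 'I_n) : `|f (step k.+1 x y) - f (step k x y)
    - (y - x) 0 k * 'D_(e_ k) f x| <= e' * `|y - x|.
  set b := (y - x) 0 k.
  have inB s : `|s| <= `|b| -> 0 <= s * b -> ball x d (s *: e_ k + step k x y).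
    move=> sb s0; rewrite ball_rVP// => j; rewrite !mxE eqxx /=.
    case: (eqVneq j k) => [->|jk]; last first.
      by rewrite mulr0 add0r; case: ifP => // _; rewrite subrr normr0.
    rewrite ltnn mulr1 addrC opprD addNKr normrN.
    by apply: le_lt_trans sb _; rewrite /b !mxE distrC.
  have der s : `|s| <= `|b| -> 0 <= s * b ->
      is_derive s (1 : R) (fun t => f (t *: e_ k + step k x y))
        ('D_(e_ k) f (s *: e_ k + step k x y)).
    move=> sb s0; apply: is_derive_along.
    by have [Us _] := dP _ (inB s sb s0); have [+ _] := fd k; exact.
  have [s [sb s0 Es]] := MVT_unordered der.
  move: Es; rewrite scale0r add0r -stepE => ->.
  rewrite [b * _]mulrC -mulrBl normrM ler_pM//.
    by have [_ /(_ k)] := dP _ (inB s sb s0); rewrite distrC => /ltW.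
  by rewrite [leRHS]/Num.Def.normr/= mx_normrE; exact: (le_bigmax _ _ (0, k)).
rewrite tele -sumrB; apply: le_trans (ler_norm_sum _ _ _) _.
apply: (@le_trans _ _ (\sum_(k < n) e' * `|y - x|)).
  by apply: ler_sum => k _; exact: edge.
rewrite sumr_const card_ord -[leLHS]mulr_natl mulrA ler_wpM2r//.
by rewrite /e' mulrCA ler_piMr ?(ltW eps0)// ler_pdivrMr// mul1r ler_nat.
Unshelve. all: by end_near. Qed.

Lemma C1_differentiable U f x : open U -> Ck 1 U f -> U x ->
  differentiable f x /\
  forall v, 'd f x v = \sum_j v 0 j * 'D_(e_ j) f x.
Proof.
move=> oU fC Ux.
pose d (v : 'rV[R]_n) : R := \sum_j v 0 j * 'D_(e_ j) f x.
have dlin : linear d.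
  move=> a u v; rewrite /d scaler_sumr -big_split/=; apply: eq_bigr => j _.
  by rewrite !mxE mulrDl scalerAl.
pose dL : {linear _ -> _} := HB.pack d (GRing.isLinear.Build _ _ _ _ _ dlin).
have dc : continuous dL.
  move=> v; apply: (@cvg_big _ _ _ _ _ (@add_continuous _) _ (nbhs v)) => j _.
  by apply: cvgMr_tmp; exact: coord_continuous.
have dE : f \o shift x = cst (f x) + dL +o_ (0 : 'rV[R]_n) id.
  apply/eqaddoP => eps eps0.
  have := C1_increment oU fC Ux eps0.
  rewrite (near_shift 0) subr0; apply: filterS => v /=.
  by rewrite addrK /d => h; rewrite opprD addrA.
have E := diff_unique dc dE.
split; last by move=> v; rewrite E.
by apply/diff_locallyP; rewrite E.
Qed.

(** The inner function is only assumed to be differentiable along the single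
    direction [v], which serves both transition maps and curves. *)
Lemma is_derive_comp_coord (V : normedModType R) U f (c : V -> 'rV[R]_n) (t v : V) :
  open U -> Ck 1 U f -> U (c t) -> (forall j, derivable (fun s => c s 0 j) t v) ->
  is_derive t v (f \o c)
    (\sum_j 'D_v (fun s => c s 0 j) t * 'D_(e_ j) f (c t)).
Proof.
move=> oU fC Uct cd.
have cdv : derivable c t v by apply/derivable_mxP => i j; rewrite (ord1 i).
pose cl (h : R) := c (h *: v + t).
have cl0 : cl 0 = c t by rewrite /cl scale0r add0r.
have dcl : differentiable cl 0.
  have cl1 : derivable cl 0 1 by exact: (proj1 (derivable1P c t v) cdv).
  exact: (proj1 (derivable1_diffP cl 0) cl1).
have [fdiff fdE] := C1_differentiable oU fC Uct.
have dfcl : differentiable (f \o cl) 0.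
  by apply: differentiable_comp => //; rewrite cl0.
apply: DeriveDef.
  have dfc1 : derivable (f \o cl) 0 1 := proj2 (derivable1_diffP _ _) dfcl.
  exact: (proj2 (derivable1P (f \o c) t v) dfc1).
rewrite derive_line -/(f \o cl) deriveE// diff_comp ?cl0//= fdE.
have <- : 'D_v c t = 'd cl 0 1 by rewrite derive_line deriveE.
by rewrite derive_mx//; apply: eq_bigr => j _; rewrite mxE.
Qed.

End ChainRule.

(** * Functions of class C^k *)

Section CkTools.
Context {R : realType}.

Lemma cvg_near_eq (T : Type) (U : topologicalType) (F : set_system T)
    (f g : T -> U) (l : U) :
  Filter F -> (\forall x \near F, f x = g x) -> f @ F --> l -> g @ F --> l.
Proof. by move=> FF fg; apply: cvg_trans (near_eq_cvg fg). Qed.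

Lemma is_derive_comp_real (V : normedModType R) (h : R -> R) (f : V -> R)
    (x v : V) (dh : R) :
  derivable f x v -> is_derive (f x) (1 : R) h dh ->
  is_derive x v (h \o f) (dh * 'D_v f x).
Proof.
move=> fd [hd hE].
pose fl (s : R) := f (s *: v + x).
have fl0 : fl 0 = f x by rewrite /fl scale0r add0r.
have fl1 : derivable fl 0 1 := proj1 (derivable1P f x v) fd.
have hd' : derivable h (fl 0) 1.
  by rewrite fl0; exact: hd.
have hfl : derivable (h \o fl) 0 1.
  have fd' := proj1 (derivable1_diffP fl 0) fl1.
  have hd'' := proj1 (derivable1_diffP h (fl 0)) hd'.
  exact: (proj2 (derivable1_diffP (h \o fl) 0) (differentiable_comp fd' hd'')).
apply: DeriveDef; first exact: (proj2 (derivable1P (h \o f) x v) hfl).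
have E := derive1_comp fl1 hd'; rewrite !derive1E in E.
rewrite (derive_line (h \o f)) (derive_line f) -hE -fl0; exact: E.
Qed.

Section Fixed.
Context {n : nat}.
Implicit Types (U : set 'rV[R]_n) (f g : 'rV[R]_n -> R).
Local Notation e_ i := (delta_mx 0 i : 'rV[R]_n).

Lemma Ck_sub k U U' f : U' `<=` U -> Ck k U f -> Ck k U' f.
Proof.
elim: k f => [|k IH] f sU [fc fd]; split=> [x /sU /fc//|]; first by [].
by move=> i; have [fi fki] := fd i; split=> [x /sU /fi//|]; exact: IH.
Qed.

Lemma Ck_le k k' U f : (k' <= k)%N -> Ck k U f -> Ck k' U f.
Proof.
move=> /subnK <-; elim: (k - k')%N => // d IH.
by rewrite addSn => /Ck_pred; exact: IH.
Qed.

Lemma Ck_local k U f :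
  (forall x, U x -> exists2 U', U' x & Ck k U' f) -> Ck k U f.
Proof.
elim: k f => [|k IH] f fU.
  by split=> // x /fU[U' U'x [fc _]]; exact: fc.
split=> [x /fU[U' U'x [fc _]]|i]; first exact: fc.
split=> [x /fU[U' U'x [_ /(_ i)[fd _]]]|]; first exact: fd.
by apply: IH => x /fU[U' U'x [_ /(_ i)[_ fd]]]; exists U'.
Qed.

Lemma Ck_sum k U (I : Type) (r : seq I) (P : pred I) (F : I -> 'rV[R]_n -> R) :
  open U -> (forall i, P i -> Ck k U (F i)) ->
  Ck k U (fun x => \sum_(i <- r | P i) F i x).
Proof.
move=> oU FC; elim: r => [|i r IH].
  rewrite (_ : (fun _ => _) = cst 0); first exact: Ck_cst.
  by apply/funext => x; rewrite big_nil.
have [Pi|/negbTE Pi] := boolP (P i).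
  rewrite (_ : (fun _ => _) = F i + (fun x => \sum_(j <- r | P j) F j x)).
    by apply: CkD => //; exact: FC.
  by apply/funext => x; rewrite big_cons Pi.
by rewrite (_ : (fun _ => _) = (fun x => \sum_(j <- r | P j) F j x))//;
  apply/funext => x; rewrite big_cons Pi.
Qed.

Lemma derive_coord (i j : 'I_n) (x : 'rV[R]_n) :
  is_derive x (e_ i) (fun y : 'rV[R]_n => y 0 j) (i == j)%:R.
Proof.
have E : (fun h : R => h^-1 *: ((h *: e_ i + x) 0 j - x 0 j)) @ 0^' --> ((i == j)%:R : R).
  refine (cvg_near_eq (f := cst ((i == j)%:R : R)) _ _ (cvg_cst _)).
  near=> h; have h0 : h != 0 by near: h; exact: nbhs_dnbhs_neq.
  by rewrite !mxE eqxx /= addrK eq_sym [RHS]mulrA mulVf// mul1r.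
apply: DeriveDef; first by apply/cvg_ex; eexists; exact: E.
exact/cvg_lim.
Unshelve. all: by end_near. Qed.

Lemma Ck_coord k U (j : 'I_n) : Ck k U (fun x => x 0 j).
Proof.
case: k => [|k]; split=> [x _|]; first exact: coord_continuous.
- by [].
- exact: coord_continuous.
move=> i; split=> [x _|]; first by have [] := derive_coord i j x.
rewrite (_ : (fun _ => _) = cst (i == j)%:R); first exact: Ck_cst.
by apply/funext => x; have [] := derive_coord i j x.
Qed.

Lemma CkV k U f : open U -> Ck k U f -> (forall x, U x -> f x != 0) ->
  Ck k U (fun x => (f x)^-1).
Proof.
move=> oU fC f0; elim: k fC => [|k IH] fC.
  by split=> // x Ux; apply: continuousV; [exact: f0|exact: Ck_continuous fC _ Ux].
have [fc fd] := fC; have Ik := IH (Ck_pred fC).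
split=> [x Ux|i]; first by apply: continuousV; [exact: f0|exact: fc].
have [fi fki] := fd i; split=> [x Ux|].
  by apply: derivableV; [exact: f0|exact: fi].
have CN : Ck k U (cst (-1) * (((fun x => (f x)^-1) * (fun x => (f x)^-1)) *
    (fun x => 'D_(e_ i) f x))).
  by apply: CkM => //; [exact: Ck_cst|apply: CkM => //; exact: CkM].
apply: Ck_eq CN => // x Ux.
by rewrite deriveV ?f0//; [rewrite !fctE mulN1r scaleNr expr2 invfM|exact: fi].
Qed.

End Fixed.

Lemma rV_continuous (T : topologicalType) n (c : T -> 'rV[R]_n) (x : T) :
  (forall j, {for x, continuous (fun y => c y 0 j)}) -> {for x, continuous c}.
Proof.
move=> cc; apply/cvg_ballP => d d0.
near=> y; rewrite ball_rVP//; near: y; apply: filter_forall => j.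
exact: ((cvgrPdist_lt _ _).1 (cc j) _ d0).
Unshelve. all: by end_near. Qed.

Lemma Ck_comp m n k (U : set 'rV[R]_m) (V : set 'rV[R]_n) f
    (c : 'rV[R]_m -> 'rV[R]_n) :
  open U -> open V -> Ck k V f -> (forall j, Ck k U (fun x => c x 0 j)) ->
  (forall x, U x -> V (c x)) -> Ck k U (f \o c).
Proof.
move=> oU oV; elim: k f => [|k IH] f fC cC cUV.
all: have fcc x : U x -> {for x, continuous (f \o c)}.
1,3: move=> Ux; apply: continuous_comp;
  [apply: rV_continuous => j; exact: Ck_continuous (cC j) _ Ux
  |exact: Ck_continuous fC _ (cUV _ Ux)].
  by split.
have D_comp i x : U x -> is_derive x (delta_mx 0 i) (f \o c)
    (\sum_j 'D_(delta_mx 0 i) (fun s => c s 0 j) x * 'D_(delta_mx 0 j) f (c x)).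
  move=> Ux; apply: (is_derive_comp_coord oV (Ck_le _ fC) (cUV _ Ux)) => // j.
  by have [_ /(_ i)[+ _]] := cC j; exact.
split=> // i; split=> [x Ux|]; first by have [] := D_comp i x Ux.
have CS : Ck k U (fun x =>
    \sum_j 'D_(delta_mx 0 i) (fun s => c s 0 j) x * 'D_(delta_mx 0 j) f (c x)).
  apply: Ck_sum => // j _; apply: CkM => //.
    by have [_ /(_ i)[_]] := cC j.
  apply: (IH (fun y => 'D_(delta_mx 0 j) f y)) => //.
    by have [_ /(_ j)[_]] := fC.
  by move=> j'; exact: Ck_pred (cC j').
by apply: Ck_eq CS => // x Ux; have [_ ->] := D_comp i x Ux.
Qed.

(** [flat 0] is the classical exp(-1/t).  The factor t^-m is there for
    induction: the derivative of [flat m] is a combination of [flat m.+1] and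
    [flat m.+2]. *)
Definition flat (m : nat) (t : R) : R :=
  if 0 < t then t^-1 ^+ m * expR (- t^-1) else 0.

Lemma flat_gt0 t : 0 < t -> 0 < flat 0 t.
Proof. by move=> t0; rewrite /flat t0 expr0 mul1r expR_gt0. Qed.

Lemma flat_le0 m t : t <= 0 -> flat m t = 0.
Proof. by rewrite /flat leNgt => /negbTE ->. Qed.

(** Since exp(y) >= y^(m+1) / (m+1)! with y = 1/t. *)
Lemma flat_bound m t : `|flat m t| <= (m.+1)`!%:R * `|t|.
Proof.
rewrite /flat; case: ifPn => [t0|_]; last by rewrite normr0 mulr_ge0.
rewrite (ger0_norm (ltW t0)) ger0_norm; last first.
  by rewrite mulr_ge0 ?exprn_ge0 ?invr_ge0 ?(ltW t0) ?expR_ge0.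
rewrite expRN ler_pdivrMr ?expR_gt0//.
have y0 : 0 <= t^-1 by rewrite invr_ge0 ltW.
have F0 : 0 < (m.+1)`!%:R :> R by rewrite ltr0n fact_gt0.
have := expR_ge1Dxn m y0; rewrite -(ler_pM2l (mulr_gt0 F0 t0)).
apply: le_trans; rewrite mulrDr mulr1 exprS.
apply: (@le_trans _ _ ((m.+1)`!%:R * t * (t^-1 * t^-1 ^+ m / (m.+1)`!%:R))).
  rewrite le_eqVlt; apply/orP; left; apply/eqP; field.
  by rewrite !gt_eqF//=.
by rewrite lerDr mulr_ge0// ltW.
Qed.

Lemma flat_cvg0 m : flat m t @[t --> 0] --> 0.
Proof.
have C0 : (m.+1)`!%:R * `|t| @[t --> (0 : R)] --> 0.
  rewrite -[X in _ --> X](mulr0 (m.+1)`!%:R); apply: cvgMl_tmp.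
  by rewrite -[X in _ --> X](@normr0 _ R^o); apply: cvg_norm; exact: cvg_id.
apply: norm_cvg0.
apply: (squeeze_cvgr _ (cvg_cst 0) C0); apply: nearW => t.
by rewrite normr_ge0 flat_bound.
Qed.

Lemma is_derive_flat m (t : R) :
  is_derive t (1 : R) (flat m) (- m%:R * flat m.+1 t + flat m.+2 t).
Proof.
have [t0|t0|->] := ltgtP t 0.
- rewrite !flat_le0 ?ltW// mulr0 addr0.
  refine (near_eq_is_derive _ (is_derive_cst (0 : R) t (1 : R))).
  by near=> s; rewrite flat_le0// ltW//; near: s; exact: lt_nbhsl.
- suff D : is_derive t (1 : R) (fun s : R => s^-1 ^+ m * expR (- s^-1))
      (- m%:R * flat m.+1 t + flat m.+2 t).
    refine (near_eq_is_derive _ D).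
    by near=> s; rewrite /flat ifT//; near: s; exact: lt_nbhsr.
  have tn0 : t != 0 by rewrite gt_eqF.
  have dV : is_derive t (1 : R) (fun s : R => s^-1) (- t^-1 ^+ 2).
    have := @is_deriveV R id t 1 1 tn0 (is_derive_id t 1).
    by rewrite [_ *: 1]mulr1 exprVn.
  have dE : is_derive t (1 : R) (fun s : R => expR (- s^-1)) (expR (- t^-1) * t^-1 ^+ 2).
    have [dN dNE] := is_deriveN dV.
    have := is_derive_comp_real dN (is_derive_expR _).
    by rewrite dNE opprK.
  have dX : is_derive t (1 : R) (fun s : R => s^-1 ^+ m) (- m%:R * t^-1 ^+ m.+1).
    have := is_deriveX m dV; rewrite exprfctE.
    suff -> : (m%:R * t^-1 ^+ m.-1) *: - t^-1 ^+ 2 = - m%:R * t^-1 ^+ m.+1 by [].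
    case: (m) => [|k]; first by rewrite !mul0r oppr0 mul0r scale0r.
    by rewrite /GRing.scale/= !exprS; move: (t^-1) => u; ring.
  have := is_deriveM dX dE.
  set d := (X in is_derive _ _ _ X -> _).
  suff -> : d = - m%:R * flat m.+1 t + flat m.+2 t by [].
  rewrite /d /flat t0 /GRing.scale /= !exprS expr0.
  have H (a u E c : R) : a * (E * (u * (u * 1))) + E * (c * (u * a))
    = c * (u * a * E) + u * (u * a) * E by ring.
  exact: H.
rewrite !flat_le0 ?mulr0 ?addr0//.
have E : (fun h : R => h^-1 *: (flat m (h *: (1 : R) + 0) - flat m 0)) @ 0^' --> (0 : R).
  have : flat m.+1 h @[h --> 0^'] --> 0.
    exact: cvg_trans (cvg_app _ (@nbhs_dnbhs _ _)) (@flat_cvg0 m.+1).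
  move=> flatC; refine (cvg_near_eq _ _ flatC); near=> h.
  rewrite [flat m 0]flat_le0// subr0 addr0 [_ *: 1]mulr1 /flat.
  by case: ifP => _; rewrite /GRing.scale/= ?mulr0// exprS mulrA.
apply: DeriveDef; first by apply/cvg_ex; eexists; exact: E.
exact/cvg_lim.
Unshelve. all: by end_near. Qed.

Lemma Ck_flat n k m (U : set 'rV[R]_n) f : open U -> Ck k U f -> Ck k U (flat m \o f).
Proof.
move=> oU; elim: k m f => [|k IH] m f fC.
all: have fcc x : U x -> {for x, continuous (flat m \o f)}.
1,3: move=> Ux; apply: continuous_comp; [exact: Ck_continuous fC _ Ux|];
  apply: differentiable_continuous; apply/derivable1_diffP;
  by have [] := is_derive_flat m (f x).
  by split.
have [_ fd] := fC.
have D_comp i x : U x -> is_derive x (delta_mx 0 i) (flat m \o f)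
    ((- m%:R * flat m.+1 (f x) + flat m.+2 (f x)) * 'D_(delta_mx 0 i) f x).
  move=> Ux; apply: is_derive_comp_real; last exact: is_derive_flat.
  by have [+ _] := fd i; exact.
split=> // i; split=> [x Ux|]; first by have [] := D_comp i x Ux.
have CS : Ck k U ((cst (- m%:R) * (flat m.+1 \o f) + (flat m.+2 \o f))
    * (fun x => 'D_(delta_mx 0 i) f x)).
  apply: CkM => //; last by have [_] := fd i.
  apply: CkD => //; last exact: IH (Ck_pred fC).
  by apply: CkM => //; [exact: Ck_cst|exact: IH (Ck_pred fC)].
by apply: Ck_eq CS => // x Ux; have [_ ->] := D_comp i x Ux.
Qed.

End CkTools.

(** * Hadamard's lemma *)

Section Hadamard.
Context {R : realType} {n : nat}.
Variables (x0 : 'rV[R]_n) (r : R).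
Let B := ball x0 r.
Implicit Types (f g : 'rV[R]_n -> R) (x : 'rV[R]_n) (t : R).
Local Notation e_ i := (delta_mx 0 i : 'rV[R]_n).
Local Notation mu := (@lebesgue_measure R).

Let oB : open B. Proof. exact: ball_open. Qed.

Definition seg x t : 'rV[R]_n := x0 + t *: (x - x0).

Lemma seg_ball x t : B x -> t \in `[0, 1] -> B (seg x t).
Proof.
rewrite in_itv/= => Bx /andP[t0 t1].
rewrite /B -ball_normE/= /seg opprD addNKr normrN normrZ ger0_norm//.
move: Bx; rewrite /B -ball_normE/= distrC; apply: le_lt_trans.
by rewrite ler_piMl.
Qed.

Lemma seg_continuous : continuous (fun p : 'rV[R]_n * R => seg p.1 p.2).
Proof.
move=> p; apply: cvgD; first exact: cvg_cst.
apply: cvgZ; first exact: cvg_snd.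
by apply: cvgB; [exact: cvg_fst|exact: cvg_cst].
Qed.

Lemma segr_continuous x : continuous (seg x).
Proof.
move=> t; apply: cvgD; first exact: cvg_cst.
by apply: cvgZ; [exact: cvg_id|exact: cvg_cst].
Qed.

(** Tube lemma: the segment from [x0] to [x] is compact. *)
Lemma seg_uniform g x (eps : R) : (forall y, B y -> {for y, continuous g}) ->
  B x -> 0 < eps ->
  \forall y \near x, forall t, t \in `[0, 1] -> `|g (seg y t) - g (seg x t)| <= eps.
Proof.
move=> gc Bx e0.
have /compact_near_coveringP := @segment_compact R 0 1.
move=> /(_ _ (nbhs x) (fun y t => `|g (seg y t) - g (seg x t)| <= eps)); apply.
move=> t t01; have Bs := seg_ball Bx t01.
have e20 : 0 < eps / 2 by rewrite divr_gt0.
have c1 : {for (x, t), continuous (fun p : 'rV[R]_n * R => g (seg p.1 p.2))}.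
  apply: (@continuous_comp _ _ _ (fun p : 'rV[R]_n * R => seg p.1 p.2) g).
    exact: seg_continuous.
  exact: gc.
have c2 : {for (x, t), continuous (fun p : 'rV[R]_n * R => g (seg x p.2))}.
  apply: (@continuous_comp _ _ _ (fun p : 'rV[R]_n * R => p.2) (g \o seg x)).
    exact: cvg_snd.
  by apply: continuous_comp; [exact: segr_continuous|exact: gc].
have N1 := (cvgrPdist_lt _ _).1 c1 _ e20.
have N2 := (cvgrPdist_lt _ _).1 c2 _ e20.
have [[U V] [/= xU tV] UV] :=
  filterI (N1 (nbhs_filter _)) (N2 (nbhs_filter _)).
exists (V, U) => //= -[s y] [/= Vs Uy].
have [/= h1 h2] := UV (y, s) (conj Uy Vs).
rewrite -(subrKA (g (seg x t))) [leRHS]splitr.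
by apply: le_trans (ler_normD _ _) _; rewrite lerD ?(ltW h2)// distrC ltW.
Qed.

Lemma seg_within m g x : (forall y, B y -> {for y, continuous g}) -> B x ->
  {within `[0, 1], continuous (fun t => t ^+ m * g (seg x t))}.
Proof.
move=> gc Bx; apply/continuous_in_subspaceT => t; rewrite inE => t01.
apply: cvgM; first exact: exprn_continuous.
apply: (@continuous_comp _ _ _ (seg x) g); last exact: gc _ (seg_ball Bx t01).
exact: segr_continuous.
Qed.

Lemma seg_integrable m g x : (forall y, B y -> {for y, continuous g}) -> B x ->
  mu.-integrable `[0, 1] (EFin \o (fun t => t ^+ m * g (seg x t))).
Proof.
by move=> gc Bx; apply: continuous_compact_integrable;
  [exact: segment_compact|exact: seg_within].
Qed.

(** The weight t^m makes the family stable under differentiation: each partial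
    derivative produces one more factor t. *)
Definition segint m g x : R := \int[mu]_(t in `[0, 1]) (t ^+ m * g (seg x t)).

Lemma segint_continuous m g x : (forall y, B y -> {for y, continuous g}) ->
  B x -> {for x, continuous (segint m g)}.
Proof.
move=> gc Bx; apply: (proj2 (cvgrPdist_le (FF := nbhs_filter x) _ _)) => eps eps0.
have nB : \forall y \near x, B y by exact: open_nbhs_nbhs.
near=> y.
have By : B y by near: y.
have Hy t : t \in `[0, 1] -> `|g (seg y t) - g (seg x t)| <= eps.
  by move: t; near: y; exact: seg_uniform.
have ix := seg_integrable m gc Bx; have iy := seg_integrable m gc By.
rewrite /segint -RintegralB//.
apply: le_trans (le_normr_Rintegral _ _) _ => //.
  exact: integrableB ix iy.
apply: (@le_trans _ _ (\int[mu]_(t in `[0, 1]) (cst eps t))).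
  apply: le_Rintegral => //.
  - by apply: integrable_norm; exact: integrableB ix iy.
  - apply: continuous_compact_integrable; first exact: segment_compact.
    by apply: continuous_subspaceT; exact: cst_continuous.
  move=> t t01; rewrite -mulrBr normrM /cst.
  move: (t01); rewrite /= in_itv/= => /andP[t0 t1].
  rewrite -[leRHS]mul1r ler_pM//; last by rewrite distrC Hy.
  by rewrite ger0_norm ?exprn_ge0// exprn_ile1.
by rewrite Rintegral_cst//= lebesgue_measure_itv/= lte_fin ltr01 oppr0 adde0 mulr1.
Unshelve. all: by end_near. Qed.

Lemma segint_derive m f x i : Ck 1 B f -> B x ->
  is_derive x (e_ i) (segint m f) (segint m.+1 (fun y => 'D_(e_ i) f y) x).
Proof.
move=> [fc /= fd] Bx; have [fdi [Dc _]] := fd i.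
pose D y := 'D_(e_ i) f y.
have lineC : {for 0, continuous (fun h : R => h *: e_ i + x)}.
  by apply: cvgD; [apply: cvgZr_tmp; exact: cvg_id|exact: cvg_cst].
have line0 : 0 *: e_ i + x = x by rewrite scale0r add0r.
have nearB : \forall h \near (0 : R), B (h *: e_ i + x).
  by apply: lineC; rewrite line0; exact: open_nbhs_nbhs.
have nearU : \forall h \near (0 : R), forall t, t \in `[0, 1] ->
    `|D (seg (h *: e_ i + x) t) - D (seg x t)| <= 1.
  apply: (lineC (fun y => forall t, t \in `[0, 1] -> `|D (seg y t) - D (seg x t)| <= 1)).
  by rewrite line0; exact: seg_uniform.
have [d /= d0 dP] : \forall h \near (0 : R), B (h *: e_ i + x) /\
    forall t, t \in `[0, 1] -> `|D (seg (h *: e_ i + x) t) - D (seg x t)| <= 1.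
  by near=> h; split; near: h.
have dP' h : h \in `](- d), d[ -> B (h *: e_ i + x) /\
    forall t, t \in `[0, 1] -> `|D (seg (h *: e_ i + x) t) - D (seg x t)| <= 1.
  move=> hd; apply: dP; rewrite /ball_/= sub0r normrN ltr_norml.
  by move: hd; rewrite in_itv.
pose F (h t : R) := t ^+ m * f (seg (h *: e_ i + x) t).
have dF h t : h \in `](- d), d[ -> t \in `[0, 1] ->
    is_derive h (1 : R) (F^~ t) (t ^+ m.+1 * D (seg (h *: e_ i + x) t)).
  move=> hd t01.
  have segE (s : R) : seg (s *: e_ i + x) t = (t * s) *: e_ i + seg x t.
    by rewrite /seg -addrA scalerDr scalerA addrCA.
  have dt : is_derive h (1 : R) (fun s : R => t * s) t.
    have := is_deriveZ t (is_derive_id h (1 : R)).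
    by rewrite [_ *: _]mulr1.
  have df : is_derive (t * h) (1 : R) (fun s : R => f (s *: e_ i + seg x t))
      (D (seg (h *: e_ i + x) t)).
    rewrite segE; apply: is_derive_along; rewrite -segE.
    by apply: fdi; apply: seg_ball => //; have [] := dP' h hd.
  have [dt1 dt2] := dt.
  have := is_deriveZ (t ^+ m) (is_derive_comp_real dt1 df).
  rewrite dt2.
  have -> : t ^+ m *: (D (seg (h *: e_ i + x) t) * t) =
     t ^+ m.+1 * D (seg (h *: e_ i + x) t).
    by rewrite /GRing.scale/= exprSr -mulrA [t * _]mulrC.
  suff -> : F^~ t = t ^+ m *: ((fun s : R => f (s *: e_ i + seg x t))
      \o (fun s : R => t * s)) by [].
  by apply/funext => s; rewrite /F segE.
have H0 : 0 \in `](- d), d[ by rewrite in_itv/= oppr_lt0 d0.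
have intF h : h \in `](- d), d[ -> mu.-integrable `[0, 1] (EFin \o F h).
  by move=> hd; have [Bh _] := dP' h hd; exact: seg_integrable.
have derF h t : h \in `](- d), d[ -> `[0, 1]%classic t -> derivable (F^~ t) h 1.
  by move=> hd t01; have [] := dF h t hd t01.
(* A bound for the derivative that is uniform in h. *)
pose G t := `|t ^+ m.+1 * D (seg x t)| + 1.
have G0 t : 0 <= G t by rewrite addr_ge0.
have intG : mu.-integrable `[0, 1] (EFin \o G).
  apply: continuous_compact_integrable; first exact: segment_compact.
  have wc := seg_within (m := m.+1) Dc Bx.
  by move=> t; apply: cvgD; [apply: cvg_norm; exact: (wc t)|exact: cvg_cst].
have Gub h t : h \in `](- d), d[ -> `[0, 1]%classic t -> `|partial1of2 F h t| <= G t.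
  move=> hd t01; rewrite partial1of2E; have [_ ->] := dF h t hd t01.
  have [_ /(_ t t01) Ut] := dP' h hd.
  rewrite -(subrK (D (seg x t)) (D (seg (_ + _) t))) mulrDr.
  apply: le_trans (ler_normD _ _) _; rewrite /G addrC lerD2l normrM.
  move: (t01); rewrite /= in_itv/= => /andP[t0 t1].
  by rewrite -[leRHS]mulr1 ler_pM// ger0_norm ?exprn_ge0// exprn_ile1.
have := @cvg_differentiation_under_integral R _ _ mu F `[0, 1]
  (measurable_itv _) 0 (- d) d H0 intF derF G G0 intG Gub.
rewrite (_ : \int[mu]_(y in `[0, 1]) partial1of2 F 0 y = segint m.+1 D x); last first.
  apply: eq_Rintegral => t; rewrite inE => t01.
  by rewrite partial1of2E; have [_ ->] := dF 0 t H0 t01; rewrite line0.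
rewrite (_ : (fun h : R => _) = (fun h => h^-1 *: (segint m f (h *: e_ i + x)
    - segint m f x))); last first.
  by apply/funext => h; rewrite addr0 /F line0.
move=> E; apply: DeriveDef; first by apply/cvg_ex; eexists; exact: E.
exact/cvg_lim.
Unshelve. all: by end_near. Qed.

(** The derivative beyond the k-th makes the partial derivatives continuous, which
    is what differentiation under the integral sign uses. *)
Lemma Ck_segint k m f : Ck k.+1 B f -> Ck k B (segint m f).
Proof.
elim: k m f => [|k IH] m f fC.
  split=> // x Bx; apply: segint_continuous => // y By.
  exact: Ck_continuous fC _ By.
split=> [x Bx|i].
  by apply: segint_continuous => // y By; exact: Ck_continuous fC _ By.
have fC1 : Ck 1 B f by exact: Ck_le fC.
split=> [x Bx|]; first by have [] := segint_derive m i fC1 Bx.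
have [_ /(_ i)[_ dC]] := fC.
apply: Ck_eq (IH m.+1 _ dC) => // x Bx.
by have [_ ->] := segint_derive m i fC1 Bx.
Qed.

Lemma Rintegral_lincomb (I : Type) (s : seq I) (a : I -> R)
    (F : I -> R -> R) (D : set R) :
  measurable D -> (forall j, mu.-integrable D (EFin \o F j)) ->
  \int[mu]_(t in D) (\sum_(j <- s) a j * F j t)
  = \sum_(j <- s) a j * \int[mu]_(t in D) F j t.
Proof.
move=> mD iF.
have iaF j : mu.-integrable D (EFin \o (fun t => a j * F j t)).
  have -> : EFin \o (fun t => a j * F j t) = (fun t => (a j)%:E * (EFin \o F j) t)%E.
    by apply/funext => t; rewrite /= EFinM.
  exact: integrableZl.
elim: s => [|j s IH].
  under eq_Rintegral do rewrite big_nil.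
  by rewrite big_nil Rintegral_cst// mul0r.
under eq_Rintegral do rewrite big_cons.
rewrite big_cons RintegralD//.
  by rewrite IH RintegralZl.
have -> : EFin \o (fun t => \sum_(j <- s) a j * F j t)
    = (fun t => \sum_(j <- s) (a j * F j t)%R%:E)%E.
  by apply/funext => t; rewrite /= sumEFin.
by apply: integrable_sum => // i _; exact: iaF.
Qed.

(** The fundamental theorem of calculus on the segment from [x0] to [x]. *)
Lemma hadamard f x : Ck 1 B f -> B x ->
  f x = f x0 + \sum_j (x 0 j - x0 0 j) * segint 0 (fun y => 'D_(e_ j) f y) x.
Proof.
move=> fC Bx; have [fc /= fd] := fC.
pose phi t := f (seg x t).
pose psi t := \sum_j (x 0 j - x0 0 j) * 'D_(e_ j) f (seg x t).
have dphi t : B (seg x t) -> is_derive t (1 : R) phi (psi t).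
  move=> Bs.
  have coordD j : is_derive t (1 : R) (fun s : R => seg x s 0 j) (x 0 j - x0 0 j).
    have := is_deriveD (is_derive_cst (x0 0 j) t (1 : R))
      (is_deriveM (is_derive_id t (1 : R)) (is_derive_cst (x 0 j - x0 0 j) t (1 : R))).
    rewrite scaler0 !add0r [_ *: 1]mulr1.
    suff -> : (fun s => seg x s 0 j) = (cst (x0 0 j) + id * cst (x 0 j - x0 0 j)) by [].
    by apply/funext => s; rewrite /seg !mxE.
  have := is_derive_comp_coord oB fC Bs (fun j => (let: DeriveDef d _ := coordD j in d)).
  suff -> : \sum_j 'D_1 (fun s : R => seg x s 0 j) t * 'D_(e_ j) f (seg x t) = psi t by [].
  by apply: eq_bigr => j _; have [_ ->] := coordD j.
have in01 t : t \in `]0, 1[ -> t \in `[0, 1].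
  by rewrite !in_itv/= => /andP[/ltW -> /ltW ->].
have psic : {within `[0, 1], continuous psi}.
  apply/continuous_in_subspaceT => t; rewrite inE => t01.
  apply: (@cvg_big _ _ _ _ _ (@add_continuous _) _ (nbhs t)) => j _.
  apply: cvgMl_tmp.
  apply: (@continuous_comp _ _ _ (seg x) (fun y => 'D_(e_ j) f y)).
    exact: segr_continuous.
  by have [_ [Dc _]] := fd j; exact: Dc _ (seg_ball Bx t01).
have phic t : t \in `[0, 1] -> {for t, continuous phi}.
  move=> t01; apply: differentiable_continuous; apply/derivable1_diffP.
  by have [] := dphi t (seg_ball Bx t01).
have LR : derivable_oo_LRcontinuous phi 0 1.
  split=> [t t01||].
  - by have [] := dphi t (seg_ball Bx (in01 t t01)).
  - by apply: cvg_at_right_filter; apply: phic; rewrite in_itv/= lexx ler01.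
  - by apply: cvg_at_left_filter; apply: phic; rewrite in_itv/= lexx ler01.
have dE : {in `]0, 1[, (phi^`())%classic =1 psi}.
  by move=> t t01; rewrite derive1E; have [_ ->] := dphi t (seg_ball Bx (in01 t t01)).
have := continuous_FTC2 ltr01 psic LR dE.
have -> : phi 1 = f x by rewrite /phi /seg scale1r addrC subrK.
have -> : phi 0 = f x0 by rewrite /phi /seg scale0r addr0.
have intD j : mu.-integrable `[0, 1] (EFin \o (fun t => t ^+ 0 * 'D_(e_ j) f (seg x t))).
  by have [_ [Dc _]] := fd j; exact: (seg_integrable 0 (g := fun y => 'D_(e_ j) f y)).
move=> FTC.
have -> : \sum_j (x 0 j - x0 0 j) * segint 0 (fun y => 'D_(e_ j) f y) x
    = \int[mu]_(t in `[0, 1]) psi t.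
  have -> : \int[mu]_(t in `[0, 1]) psi t =
      \int[mu]_(t in `[0, 1]) (\sum_j (x 0 j - x0 0 j) * (t ^+ 0 * 'D_(e_ j) f (seg x t))).
    by apply: eq_Rintegral => t _; apply: eq_bigr => j _; rewrite expr0 mul1r.
  rewrite Rintegral_lincomb//.
by rewrite /Rintegral FTC /= [RHS]addrC subrK.
Qed.

End Hadamard.

(** * Local smoothness and bump functions *)

Section LocalSmoothness.
Context {R : realType} {n : nat} (M : manifold R n).
Implicit Types (N W K : set M) (f g w : M -> R) (c : chart R n M) (p q : M).

Definition smooth_in N f : Prop := forall c, atlas c ->
  smooth_on (chart_map c @` (chart_dom c `&` N)) (f \o chart_inv c).

Lemma chart_open_image c N : open N -> open (chart_map c @` (chart_dom c `&` N)).
Proof.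
move=> oN; rewrite openE => _ [q [dq Nq] <-]; rewrite /interior.
have Ux : (chart_map c @` chart_dom c) (chart_map c q) by exists q.
have nU : \forall x \near chart_map c q, (chart_map c @` chart_dom c) x.
  by apply: open_nbhs_nbhs; split => //; exact: chart_img_open.
have nN : \forall x \near chart_map c q, N (chart_inv c x).
  have := chart_inv_cont Ux; apply; rewrite chart_mapK//.
  exact: open_nbhs_nbhs.
near=> x; have [q' dq' E] : (chart_map c @` chart_dom c) x by near: x.
exists q' => //; split => //.
rewrite -(chart_mapK dq') E; by near: x.
Unshelve. all: by end_near. Qed.

Lemma smooth_smooth_in N f : smooth f -> smooth_in N f.
Proof.
move=> sf c ac k; apply: Ck_sub (sf c ac k).
by move=> _ [q [dq _] <-]; exists q.
Qed.

Lemma smooth_local f : (forall p, exists2 N, N p & smooth_in N f) -> smooth f.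
Proof.
move=> loc c ac k; apply: Ck_local => _ [q dq <-].
have [N Nq sN] := loc q; exists (chart_map c @` (chart_dom c `&` N)).
  by exists q.
exact: sN.
Qed.

Lemma smooth_in_eq N f g : open N -> (forall q, N q -> f q = g q) ->
  smooth_in N f -> smooth_in N g.
Proof.
move=> oN fg sf c ac k; apply: Ck_eq (sf c ac k); first exact: chart_open_image.
by move=> _ [q [dq Nq] <-] /=; rewrite chart_mapK// fg.
Qed.

Lemma smooth_inM N f g : open N -> smooth_in N f -> smooth_in N g ->
  smooth_in N (f * g).
Proof.
move=> oN sf sg c ac k; have := CkM (chart_open_image oN) (sf c ac k) (sg c ac k).
exact.
Qed.

Lemma smooth_inV N f : open N -> smooth_in N f -> (forall q, N q -> f q != 0) ->
  smooth_in N (fun q => (f q)^-1).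
Proof.
move=> oN sf f0 c ac k; apply: (CkV (chart_open_image oN) (sf c ac k)).
by move=> _ [q [dq Nq] <-] /=; rewrite chart_mapK// f0.
Qed.

(** In another chart the function is [u] composed with a transition map. *)
Lemma smooth_in_chart c N (u : 'rV[R]_n -> R) : atlas c -> open N ->
  smooth_on (chart_map c @` (chart_dom c `&` N)) u ->
  smooth_in (chart_dom c `&` N) (u \o chart_map c).
Proof.
move=> ac oN su c' ac' k.
have oD : open (chart_dom c `&` N) by apply: openI => //; exact: chart_dom_open.
apply: (@Ck_comp _ _ _ _ _ (chart_map c @` (chart_dom c `&` N)) u
  (fun x => chart_map c (chart_inv c' x))).
- exact: chart_open_image.
- exact: chart_open_image.
- exact: su.
- move=> j; apply: Ck_sub (atlas_compat ac' ac j k).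
  by move=> _ [q [dq' [dq _]] <-]; exists q.
- by move=> _ [q [dq' [dq Nq]] <-]; rewrite chart_mapK//; exists q.
Qed.

(** [w] is an arbitrary total function outside [N]: there the product is locally
    zero, since the complement of [K] is open. *)
Lemma smooth_cutoff chi K N w : smooth chi -> closed K -> open N -> K `<=` N ->
  (forall q, ~ K q -> chi q = 0) -> smooth_in N w -> smooth (chi * w).
Proof.
move=> schi cK oN KN chi0 sw; apply: smooth_local => p.
have [Kp|nKp] := pselect (K p).
  exists N; first exact: KN.
  by apply: smooth_inM => //; exact: smooth_smooth_in.
exists (~` K) => //; apply: (smooth_in_eq (f := cst 0)).
- exact: closed_openC.
- by move=> q nKq; rewrite !fctE chi0// mul0r.
- by apply: smooth_smooth_in; exact: smooth_cst.
Qed.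

Lemma smooth_continuous f : smooth f -> continuous f.
Proof.
move=> sf p; have [c ac dp] := atlas_cover p.
have nD : \forall q \near p, (f \o chart_inv c) (chart_map c q) = f q.
  have : \forall q \near p, chart_dom c q.
    by apply: open_nbhs_nbhs; split => //; exact: chart_dom_open.
  by apply: filterS => q dq /=; rewrite chart_mapK.
have cf : (f \o chart_inv c) (chart_map c q) @[q --> p] --> f p.
  have -> : f p = (f \o chart_inv c) (chart_map c p) by rewrite /= chart_mapK.
  apply: (@continuous_comp _ _ _ (chart_map c) (f \o chart_inv c)).
    exact: chart_map_cont.
  by apply: (Ck_continuous (sf c ac 0%N)); exists p.
exact: cvg_trans (near_eq_cvg nD) cf.
Qed.

(** A compact box around the image of [p] has compact image in [M], which is
    closed because [M] is Hausdorff; extension by zero outside of it is therefore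
    smooth. *)
Lemma bump c p N : atlas c -> chart_dom c p -> open N -> N p ->
  exists chi K, [/\ smooth chi, closed K, K `<=` chart_dom c `&` N,
    (forall q, ~ K q -> chi q = 0) & chi p = 1].
Proof.
move=> ac dp oN Np; set x0 := chart_map c p.
set V := chart_map c @` (chart_dom c `&` N).
have oD : open (chart_dom c `&` N) by apply: openI => //; exact: chart_dom_open.
have oV : open V by exact: chart_open_image.
have Vx0 : V x0 by exists p.
have /nbhs_ballP[d /= d0 dV] : nbhs x0 V by exact: open_nbhs_nbhs.
pose r := d / 2; have r0 : 0 < r by rewrite divr_gt0.
pose box := [set x : 'rV[R]_n | forall j, `[x0 0 j - r, x0 0 j + r]%classic (x ord0 j)].
have cbox : compact box.
  by apply: (@rV_compact R n (fun j => `[x0 0 j - r, x0 0 j + r]%classic)) => j;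
    exact: segment_compact.
have boxV : box `<=` V.
  move=> x bx; apply: dV; rewrite ball_rVP// => j.
  have := bx j; rewrite /= in_itv/= => /andP[h1 h2].
  have rd : r < d by rewrite /r ltr_pdivrMr// ltr_pMr// ltr1n.
  rewrite ltr_norml; apply/andP; split; lra.
have imgV x : V x -> (chart_map c @` chart_dom c) x.
  by move=> [q [dq _] <-]; exists q.
pose K := chart_inv c @` box.
have KD : K `<=` chart_dom c `&` N.
  by move=> _ [x /boxV [q [dq Nq] <-] <-]; rewrite chart_mapK.
have cK : closed K.
  apply: compact_closed; first exact: manifold_hausdorff.
  apply: continuous_compact => //; apply: continuous_in_subspaceT => x.
  by rewrite inE => /boxV /imgV; exact: chart_inv_cont.
(* Positive at x0 and nonpositive outside the box. *)
pose s (x : 'rV[R]_n) : R := r ^+ 2 - \sum_j (x 0 j - x0 0 j) ^+ 2.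
have sC k U : open U -> Ck k U s.
  move=> oU; have CB j : Ck k U (fun x => x 0 j - x0 0 j).
    have := CkD oU (Ck_coord k U j) (Ck_cst k U (- x0 0 j)); exact.
  have C2 : Ck k U (cst (-1) * (fun x => \sum_j (x 0 j - x0 0 j) ^+ 2)).
    apply: CkM => //; first exact: Ck_cst.
    by apply: Ck_sum => // j _; have := CkM oU (CB j) (CB j); exact.
  have := CkD oU (Ck_cst k U (r ^+ 2)) C2.
  by apply: Ck_eq => // x _; rewrite !fctE mulN1r.
have s0 : s x0 = r ^+ 2.
  by rewrite /s big1 ?subr0// => j _; rewrite subrr expr0n.
have sneg x : ~ box x -> s x <= 0.
  move=> nbx; have [j jx] : exists j, ~ `[x0 0 j - r, x0 0 j + r]%classic (x ord0 j).
    by apply/existsNP.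
  rewrite subr_le0 (bigD1 j)//=; apply: ler_wpDr.
    by apply: sumr_ge0 => i _; exact: sqr_ge0.
  rewrite -[leRHS]real_normK ?num_real// ler_sqr ?nnegrE ?(ltW r0)//.
  apply: contra_notT jx; rewrite -ltNge ltr_norml /= in_itv/= => /andP[h1 h2].
  by apply/andP; split; lra.
pose chi0 x := flat 0 (s x) / flat 0 (r ^+ 2).
pose chi q := if `[< (chart_dom c `&` N) q >] then chi0 (chart_map c q) else 0.
have chiK q : ~ K q -> chi q = 0.
  move=> nKq; rewrite /chi; case: asboolP => // -[dq Nq].
  rewrite /chi0 flat_le0 ?mul0r//; apply: sneg => bq; apply: nKq.
  by exists (chart_map c q) => //; rewrite chart_mapK.
exists chi, K; split => //; last first.
  rewrite /chi asboolT// /chi0 s0 divff// gt_eqF// flat_gt0// exprn_gt0//.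
apply: smooth_local => q; have [Kq|nKq] := pselect (K q).
  exists (chart_dom c `&` N); first exact: KD.
  apply: (smooth_in_eq (f := chi0 \o chart_map c)) => //.
    by move=> q' Dq'; rewrite /chi asboolT.
  apply: smooth_in_chart => // k.
  have := CkM oV (Ck_flat 0 oV (sC k V oV)) (Ck_cst k V (flat 0 (r ^+ 2))^-1); exact.
exists (~` K) => //; apply: (smooth_in_eq (f := cst 0)).
- exact: closed_openC.
- by move=> q' nKq'; rewrite chiK.
- by apply: smooth_smooth_in; exact: smooth_cst.
Qed.

End LocalSmoothness.

(** * Coordinate description of tangent spaces *)

Section TangentSpaces.
Context {R : realType} {n : nat} (M : manifold R n).
Implicit Types (c : chart R n M) (p q : M) (f : Cinf M).
Local Notation e_ i := (delta_mx 0 i : 'rV[R]_n).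

Definition partial c (i : 'I_n) q (f : Cinf M) : R :=
  'D_(e_ i) (f \o chart_inv c) (chart_map c q).

Lemma chart_derivable c f q i : atlas c -> chart_dom c q ->
  derivable (f \o chart_inv c) (chart_map c q) (e_ i).
Proof.
move=> ac dq; have [_ /(_ i)[+ _]] := Cinf_smooth f ac 1; apply.
by exists q.
Qed.

Lemma partial_derivation c i q : atlas c -> chart_dom c q ->
  derivation_at q (partial c i q).
Proof.
move=> ac dq; have df f := @chart_derivable c f q i ac dq.
split=> [a f g|f g]; rewrite /partial.
  have -> : (a *: f + g : Cinf M) \o chart_inv c =
      a *: (f \o chart_inv c) + (g \o chart_inv c) by [].
  by rewrite deriveD ?deriveZ//; exact: derivableZ.
have -> : (f * g : Cinf M) \o chart_inv c =
    (f \o chart_inv c) * (g \o chart_inv c) by [].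
rewrite deriveM; [|exact: df|exact: df].
by rewrite [in LHS]/= chart_mapK// addrC [g q *: _]mulrC.
Qed.

Lemma partial_smooth_in c i f : atlas c ->
  smooth_in (chart_dom c) (fun q => partial c i q f).
Proof.
move=> ac; have := @smooth_in_chart _ _ _ c setT
  (fun x => 'D_(e_ i) (f \o chart_inv c) x) ac openT; rewrite setIT; apply.
by move=> k; have [_ /(_ i)[_]] := Cinf_smooth f ac k.+1.
Qed.

Lemma tangentD p (v : tangent p) f g : v (f + g) = v f + v g.
Proof. by rewrite -[f]scale1r (tangentP v).1 mul1r scale1r. Qed.

Lemma tangent0 p (v : tangent p) : v 0 = 0.
Proof. by apply: (addrI (v 0)); rewrite -tangentD !addr0. Qed.

Lemma tangentZ p (v : tangent p) a f : v (a *: f) = a * v f.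
Proof. by rewrite -[a *: f]addr0 (tangentP v).1 tangent0 addr0. Qed.

Lemma tangent_sum p (v : tangent p) (I : Type) (s : seq I) (F : I -> Cinf M) :
  v (\sum_(i <- s) F i) = \sum_(i <- s) v (F i).
Proof.
elim: s => [|i s IH]; first by rewrite !big_nil tangent0.
by rewrite !big_cons tangentD IH.
Qed.

Lemma tangent1 p (v : tangent p) : v 1 = 0.
Proof.
have := (tangentP v).2 1 1; rewrite mulr1 [1 * _]mul1r [X in X + _]mulr1.
by move/eqP; rewrite -subr_eq0 opprD addNKr oppr_eq0 => /eqP.
Qed.

Lemma Cinf_eq (f g : Cinf M) : (forall q, f q = g q) -> f = g.
Proof. by move=> fg; apply/val_inj/funext. Qed.

Lemma Cinf_sumE (I : Type) (s : seq I) (F : I -> Cinf M) q :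
  (\sum_(i <- s) F i) q = \sum_(i <- s) F i q.
Proof. by elim: s => [|i s IH]; rewrite ?big_nil// !big_cons -IH. Qed.

Lemma segint0E (x0 : 'rV[R]_n) g : segint x0 0 g x0 = g x0.
Proof.
rewrite /segint (_ : Rintegral _ _ _ =
    \int[lebesgue_measure]_(t in `[0, 1]) cst (g x0) t).
  by rewrite Rintegral_cst//= lebesgue_measure_itv/= lte_fin ltr01 oppr0 adde0 mulr1.
by apply: eq_Rintegral => t _; rewrite expr0 mul1r /seg subrr scaler0 addr0.
Qed.

(** Apply [v] to the Hadamard expansion of [f] around [q], multiplied twice by a
    bump function [chi] so that both factors of each term are global.  As
    chi(q) = 1 and constants are killed, the left side gives [v f], and on the
    right each coordinate function vanishes at [q]. *)
Lemma local_coordinates c q : atlas c -> chart_dom c q ->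
  exists X : 'I_n -> Cinf M,
    (forall i j, partial c i q (X j) = (i == j)%:R) /\
    (forall (v : tangent q) f, v f = \sum_j v (X j) * partial c j q f).
Proof.
move=> ac dq; set y0 := chart_map c q.
have Uy0 : (chart_map c @` chart_dom c) y0 by exists q.
have /nbhs_ballP[r /= r0 rU] : nbhs y0 (chart_map c @` chart_dom c).
  by apply: open_nbhs_nbhs; split => //; exact: chart_img_open.
set B := ball y0 r in rU; have oB : open B by exact: ball_open.
pose N := [set q' | chart_dom c q' /\ B (chart_map c q')].
have oN : open N.
  rewrite openE => q' [dq' Bq']; rewrite /interior /N.
  have n1 : \forall z \near q', chart_dom c z.
    by apply: open_nbhs_nbhs; split => //; exact: chart_dom_open.
  have n2 : \forall z \near q', B (chart_map c z).
    by apply: (chart_map_cont dq'); exact: open_nbhs_nbhs.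
  by apply: filterS2 n1 n2.
have Nq : N q by split => //; exact: ballxx.
have [chi [K [schi cK KN chi0 chi1]]] := bump ac dq oN Nq.
have KB q' : K q' -> chart_dom c q' /\ B (chart_map c q') by move=> /KN[].
have cut (u : 'rV[R]_n -> R) : smooth_on B u -> smooth (chi * (u \o chart_map c)).
  move=> su; apply: (smooth_cutoff schi cK (openI (@chart_dom_open _ _ _ c) oN)) => //.
  apply: smooth_in_chart => // k; apply: Ck_sub (su k).
  by move=> _ [z [_ [_ Bz]] <-].
have scoord j : smooth_on B (fun x => x 0 j - y0 0 j).
  by move=> k; have := CkD oB (Ck_coord k B j) (Ck_cst k B (- y0 0 j)); exact.
pose X j : Cinf M := to_Cinf (cut _ (scoord j)).
exists X; split=> [i j|v f].
  have sB k : Ck k B (chi \o chart_inv c) by apply: Ck_sub (schi c ac k).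
  have dchi : derivable (chi \o chart_inv c) y0 (e_ i).
    by have [_ /(_ i)[+ _]] := sB 1; apply; exact: ballxx.
  have dco : is_derive y0 (e_ i) (fun x : 'rV[R]_n => x 0 j - y0 0 j) (i == j)%:R.
    have := is_deriveD (derive_coord i j y0) (is_derive_cst (- y0 0 j) y0 (e_ i)).
    by rewrite addr0.
  have [dco1 dco2] := dco.
  rewrite /partial -/y0.
  have -> : 'D_(e_ i) (X j \o chart_inv c) y0 =
     'D_(e_ i) ((chi \o chart_inv c) * (fun x : 'rV[R]_n => x 0 j - y0 0 j)) y0.
    apply: near_eq_derive.
    have nU : \forall x \near y0, (chart_map c @` chart_dom c) x.
      by apply: open_nbhs_nbhs; split => //; exact: chart_img_open.
    by apply: filterS nU => _ [z dz <-]; rewrite !fctE /= chart_mapK.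
  rewrite deriveM; [|exact: dchi|exact: dco1].
  rewrite dco2 subrr scale0r addr0 /= chart_mapK// chi1.
  by rewrite scale1r.
have su : smooth_on B (f \o chart_inv c).
  by move=> k; apply: Ck_sub (Cinf_smooth f ac k).
pose D j y := 'D_(e_ j) (f \o chart_inv c) y.
have sh j : smooth_on B (segint y0 0 (D j)).
  move=> k; apply: Ck_segint => //.
  by have [_ /(_ j)[_]] := su k.+2.
pose H j : Cinf M := to_Cinf (cut _ (sh j)).
pose Chi : Cinf M := to_Cinf schi.
have E : Chi * (Chi * (f - f q *: (1 : Cinf M))) = \sum_j X j * H j.
  apply: Cinf_eq => z; rewrite Cinf_sumE.
  have [Kz|nKz] := pselect (K z); last first.
    transitivity (0 : R); first by rewrite /= !fctE /= chi0 ?mul0r.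
    by rewrite big1// => j _; rewrite /= !fctE /= chi0 ?mul0r.
  have [dz Bz] := KB z Kz.
  have := hadamard (su 1) Bz.
  rewrite /= !chart_mapK// => fz.
  rewrite !fctE /= fz [f q *: 1]mulr1 addrC addKr !mulr_sumr.
  by apply: eq_bigr => j _; rewrite !fctE /=; ring.
have dF (a b : Cinf M) : v (a * b) = v a * b q + a q * v b := (tangentP v).2 a b.
have F0 : (f - f q *: (1 : Cinf M)) q = 0 by rewrite /= !fctE /= [_ *: 1]mulr1 subrr.
have := congr1 v E; rewrite tangent_sum !dF.
have -> : (Chi * (f - f q *: (1 : Cinf M))) q = 0.
  have -> : (Chi * (f - f q *: (1 : Cinf M))) q =
      Chi q * (f - f q *: (1 : Cinf M)) q by [].
  by rewrite F0 mulr0.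
rewrite F0 !mulr0 !add0r /= chi1 !mul1r.
have -> : v (f - f q *: (1 : Cinf M)) = v f.
  by rewrite tangentD -scaleN1r !tangentZ tangent1 !mulr0 addr0.
move=> ->; apply: eq_bigr => j _; rewrite dF.
have -> : X j q = 0 by rewrite /= !fctE /= subrr mulr0.
rewrite mul0r addr0; congr (_ * _).
by rewrite /= !fctE /= chi1 mul1r segint0E.
Qed.

(** The coordinate fields multiplied by a bump function: they are global, and
    form a basis wherever the bump function does not vanish. *)
Lemma local_frame p : exists (W : set M) (E : 'I_n -> vfield M),
  [/\ open W, W p,
     (forall q, W q -> forall v : tangent q, exists a : 'I_n -> R,
        v = \sum_i a i *: E i q) &
     (forall q, W q -> forall b : 'I_n -> R,
        \sum_i b i *: E i q = 0 -> forall i, b i = 0)].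
Proof.
have [c ac dp] := atlas_cover p.
have [chi [K [schi cK KD chi0 chi1]]] := bump ac dp openT (I : setT p).
have {}KD q : K q -> chart_dom c q by move=> /KD[].
pose E0 i q (f : Cinf M) : R := chi q * partial c i q f.
have E0d i q : derivation_at q (E0 i q).
  have [Kq|nKq] := pselect (K q); last first.
    by split=> [a f g|f g]; rewrite /E0 chi0// !mul0r ?scaler0 ?mulr0 ?addr0.
  have [Pl PM] := partial_derivation i ac (KD q Kq).
  split=> [a f g|f g]; rewrite /E0; first by rewrite Pl mulrDr [chi q * _]mulrCA.
  by rewrite PM; ring.
have E0s i f : smooth (fun q => to_tangent (E0d i q) f).
  have := smooth_cutoff schi cK (@chart_dom_open _ _ _ c) KD chi0
    (partial_smooth_in i f ac); exact.
pose E i : vfield M := VField (E0s i).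
pose W := [set q | chi q != 0].
have WK q : W q -> K q.
  by move=> Wq; apply: contrapT => nKq; move: Wq; rewrite /W /= chi0 ?eqxx.
have sumE q (b : 'I_n -> R) f :
    (\sum_i b i *: E i q) f = \sum_i b i * (chi q * partial c i q f).
  elim/big_ind2 : _ => // u a u' a' <- <-; exact.
exists W, E; split.
- have -> : W = chi @^-1` [set~ 0].
    by apply/seteqP; split=> q /= /eqP.
  apply: open_comp => [q _|]; first exact: smooth_continuous.
  by apply: closed_openC; exact: closed_eq.
- by rewrite /W /= chi1 oner_neq0.
- move=> q Wq v; have dq := KD q (WK q Wq).
  have [X [_ vX]] := local_coordinates ac dq.
  exists (fun i => v (X i) / chi q); apply: tangent_ext => f.
  rewrite vX sumE; apply: eq_bigr => i _; rewrite mulrA divfK//.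
- move=> q Wq b b0 j; have dq := KD q (WK q Wq).
  have [X [XX _]] := local_coordinates ac dq.
  have : (\sum_i b i *: E i q) (X j) = 0 by rewrite b0.
  rewrite sumE.
  rewrite (bigD1 j)//= big1 => [|i ij]; last by rewrite XX (negbTE ij) !mulr0.
  by rewrite XX eqxx mulr1 addr0 => /eqP; rewrite mulf_eq0 (negbTE Wq) orbF => /eqP.
Qed.

End TangentSpaces.

(** * The metric dual of a family of linear forms *)

Section Evaluation.
Context {R : realType} {n : nat} (M : manifold R n) (q : M).

(** Determinants and adjugates of matrices of smooth functions are evaluated
    pointwise through this ring morphism. *)
Definition ev_at (f : Cinf M) : R := f q.

Fact ev_at_zmod_morphism : zmod_morphism ev_at. Proof. by []. Qed.
Fact ev_at_monoid_morphism : monoid_morphism ev_at. Proof. by []. Qed.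

HB.instance Definition _ :=
  GRing.isZmodMorphism.Build (Cinf M) R ev_at ev_at_zmod_morphism.
HB.instance Definition _ :=
  GRing.isMonoidMorphism.Build (Cinf M) R ev_at ev_at_monoid_morphism.

End Evaluation.

Section MetricDual.
Context {R : realType} {n : nat} (M : manifold R n).
Implicit Types (X Y Z : vfield M) (B : tensor02 M) (p q : M).

Lemma tensor02D B q (v : tangent q) u w : B q (u + w) v = B q u v + B q w v.
Proof. by have := tensor02_linearl B v 1 u w; rewrite scale1r mul1r. Qed.

Lemma tensor02Z B q (v : tangent q) a u : B q (a *: u) v = a * B q u v.
Proof.
have B0 : B q 0 v = 0 by apply: (addrI (B q 0 v)); rewrite -tensor02D !addr0.
by rewrite -[a *: u]addr0 (tensor02_linearl B v) B0 addr0.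
Qed.

Lemma vfield_through p (v : tangent p) : exists Z : vfield M, Z p = v.
Proof.
have [W [E [_ Wp span _]]] := local_frame p.
have [a ->] := span p Wp v.
exists (\sum_i (to_Cinf (smooth_cst (M := M) (a i))) *: E i).
by elim/big_ind2 : _ => // u X u' X' <- <-.
Qed.

(** Nondegeneracy tests against all tangent vectors, and each of them is the
    value of a global field. *)
Lemma nondegenerate_vfield B X Y : nondegenerate B ->
  (forall Z, ev02 B X Z = ev02 B Y Z) -> X = Y.
Proof.
move=> Bnd XY; apply: vfield_ext => p; apply/eqP; rewrite -subr_eq0; apply/eqP.
apply: Bnd => v; have [Z <-] := vfield_through v.
rewrite tensor02D -scaleN1r tensor02Z mulN1r.
by have := congr1 (ev_at p) (XY Z); rewrite /ev_at /= => ->; rewrite subrr.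
Qed.

Lemma scalar_sum (V : lmodType R) (om : V -> R) (I : Type) (s : seq I)
    (a : I -> R) (u : I -> V) :
  scalar om -> om (\sum_(i <- s) a i *: u i) = \sum_(i <- s) a i * om (u i).
Proof.
move=> oml.
have om0 : om 0 = 0.
  have := oml 1 0 0; rewrite scale1r mul1r addr0 => /eqP.
  by rewrite -subr_eq0 opprD addNKr oppr_eq0 => /eqP.
by elim: s => [|i s IH]; rewrite ?big_nil// !big_cons oml IH.
Qed.

(** In a frame E the dual vector is sum_i a_i E_i with (a_i) Gram = (om(E_j)).
    The Gram matrix is invertible by nondegeneracy, which gives the dual
    pointwise; it is smooth because the inverse is the adjugate over the
    determinant, both computed in the ring of smooth functions. *)
Lemma metric_dual B (om : forall q, tangent q -> R) : nondegenerate B ->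
  (forall q, scalar (om q)) -> (forall Z, smooth (fun q => om q (Z q))) ->
  exists S : vfield M, forall q w, B q (S q) w = om q w.
Proof.
move=> Bnd oml oms.
pose gram (E : 'I_n -> vfield M) : 'M[Cinf M]_n := \matrix_(i, j) ev02 B (E i) (E j).
pose gramq q (E : 'I_n -> vfield M) : 'M[R]_n := map_mx (ev_at q) (gram E).
have combo q (E : 'I_n -> vfield M) (a : 'rV[R]_n) j :
    B q (\sum_i a 0 i *: E i q) (E j q) = (a *m gramq q E) 0 j.
  rewrite (scalar_sum _ _ _ (tensor02_linearl B (E j q))) mxE.
  by apply: eq_bigr => i _; rewrite !mxE.
have eqE q (E : 'I_n -> vfield M) u w : (forall v : tangent q, exists a : 'I_n -> R,
    v = \sum_i a i *: E i q) -> scalar u -> scalar w ->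
    (forall j, u (E j q) = w (E j q)) -> forall v : tangent q, u v = w v :> R.
  move=> span ul wl uw v; have [a ->] := span v.
  by rewrite !scalar_sum//; apply: eq_bigr => i _; rewrite uw.
have scalar0 q : scalar (fun _ : tangent q => 0 : R).
  by move=> a u v; rewrite mulr0 addr0.
have gramU q (E : 'I_n -> vfield M) : (forall v : tangent q, exists a : 'I_n -> R,
    v = \sum_i a i *: E i q) ->
    (forall b : 'I_n -> R, \sum_i b i *: E i q = 0 -> forall i, b i = 0) ->
    gramq q E \in unitmx.
  move=> span free; rewrite -row_free_unit -kermx_eq0; apply/eqP/row_matrixP => k.
  rewrite row0; set a := row k _.
  have a0 : a *m gramq q E = 0 by rewrite /a -row_mul mulmx_ker row0.
  apply/rowP => i; rewrite [RHS]mxE; apply: (free (fun i => a 0 i) _ i).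
  apply: Bnd => v.
  refine (eqE q E (B q (\sum_i a 0 i *: E i q)) (fun _ => 0 : R) span
    (@tensor02_linearr _ _ _ B _ _) (scalar0 q) _ v) => j.
  by rewrite combo a0 mxE.
have ptw q : exists u : tangent q, forall w, B q u w = om q w.
  have [W [E [_ Wq span free]]] := local_frame q.
  have gU := gramU q E (span q Wq) (free q Wq).
  pose a := (\row_j om q (E j q)) *m invmx (gramq q E).
  exists (\sum_i a 0 i *: E i q).
  move=> w.
  apply: (eqE q E (B q (\sum_i a 0 i *: E i q)) (om q) (span q Wq)
    (@tensor02_linearr _ _ _ B _ _) (oml q) _ w) => j.
  by rewrite combo /a mulmxKV// mxE.
pose S0 q : tangent q := sval (cid (ptw q)).
have S0E q w : B q (S0 q) w = om q w by rewrite /S0; case: cid.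
have S0s f : smooth (fun q => S0 q f).
  apply: smooth_local => p.
  have [W [E [oW Wp span free]]] := local_frame p.
  exists W => //.
  pose d : Cinf M := \det (gram E).
  have dE q : d q = \det (gramq q E).
    by rewrite /gramq det_map_mx.
  pose N : Cinf M := \sum_i
    (\sum_j to_Cinf (oms (E j)) * (\adj (gram E)) j i) * lie (E i) f.
  have S0W q : W q -> S0 q f = N q * (d q)^-1.
    move=> Wq; have dU := gramU q E (span q Wq) (free q Wq).
    have [a aE] := span q Wq (S0 q).
    have aG : (\row_i a i) *m gramq q E = \row_j om q (E j q).
      apply/rowP => j; rewrite -combo mxE -S0E aE; congr (B q _ _).
      by apply: eq_bigr => i _; rewrite mxE.
    have aI i : a i = (\sum_j om q (E j q) * ev_at q ((\adj (gram E)) j i)) * (d q)^-1.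
      have := congr1 (fun r => (r *m \adj (gramq q E)) 0 i) aG.
      rewrite -mulmxA mul_mx_adj mul_mx_scalar !mxE -dE => e.
      have dn0 : d q != 0 by rewrite dE -unitfE -unitmxE.
      rewrite -[LHS](mulKf dn0) e mulrC; congr (_ * _).
      by apply: eq_bigr => j _; rewrite mxE /gramq -map_mx_adj mxE.
    have -> : S0 q f = \sum_i a i * E i q f.
      rewrite {1}aE; elim/big_ind2 : _ => // u x u' x' <- <-; exact.
    rewrite /N Cinf_sumE mulr_suml; apply: eq_bigr => i _.
    rewrite aI mulrAC; congr (_ * _); rewrite [RHS]/= !fctE /=; congr (_ * _).
    by rewrite -[RHS]/((\sum_j _ : Cinf M) q) Cinf_sumE.
  apply: (smooth_in_eq (f := (N : M -> R) * (fun q => (d q)^-1))) => //.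
    by move=> q Wq; rewrite S0W.
  apply: smooth_inM => //; first exact/smooth_smooth_in/Cinf_smooth.
  apply: smooth_inV => //; first exact/smooth_smooth_in/Cinf_smooth.
  move=> q Wq; rewrite dE -unitfE -unitmxE.
  exact: gramU (span q Wq) (free q Wq).
by exists (VField S0s) => q w; rewrite /= S0E.
Qed.

End MetricDual.

(** * The algebra of connections *)

Section TensorAlgebra.
Context {R : realType} {n : nat} (M : manifold R n).
Implicit Types (X Y Z : vfield M) (B : tensor02 M) (D : connection M).

Lemma ev02Dl B X Y Z : ev02 B (X + Y) Z = ev02 B X Z + ev02 B Y Z.
Proof. by apply: Cinf_eq => q; rewrite /= tensor02D. Qed.

Lemma ev02Nl B X Z : ev02 B (- X) Z = - ev02 B X Z.
Proof. by apply: Cinf_eq => q; rewrite /= -scaleN1r tensor02Z mulN1r. Qed.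

Lemma connection_eq D D' : (forall X Y, D X Y = D' X Y) -> D = D'.
Proof.
case: D D' => [d l a e] [d' l' a' e'] /= dd.
have {}dd : d = d' by apply/funext => X; apply/funext => Y.
by rewrite dd in l a e *; congr Connection; exact: Prop_irrelevance.
Qed.

End TensorAlgebra.

Section ConnectionAlgebra.
Context {R : realType} {n : nat} (M : manifold R n).
Variables (g F : tensor02 M) (A : tensor11 M) (LC : connection M).
Hypothesis gC : forall X Y : vfield M, ev02 g X Y = ev02 g Y X.
Hypothesis FN : forall X Y : vfield M, ev02 F X Y = - ev02 F Y X.
Hypothesis gnd : nondegenerate g.
Hypothesis hA : forall X Y : vfield M, ev02 F X Y = ev02 g (ev11 A X) Y.
Hypothesis hLC : levi_civita g LC.
Implicit Types (X Y Z : vfield M) (D : connection M).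

(** s(X,Y,Z) in the notation above: the difference tensor of [D] and [LC], with
    its value lowered by [g]. *)
Definition difference D X Y Z : Cinf M := ev02 g (D X Y - LC X Y) Z.

Lemma ev02E D X Y Z : ev02 g (D X Y) Z = ev02 g (LC X Y) Z + difference D X Y Z.
Proof. by rewrite /difference ev02Dl ev02Nl addrC subrK. Qed.

Lemma skew_metric_apply X Y : ev02 F X Y = - ev02 g X (ev11 A Y).
Proof. by rewrite FN hA gC. Qed.

(** Subtracting the vanishing torsion of [LC] cancels the bracket; the next two
    lemmas subtract the corresponding covariant derivative for [LC] in the same
    way, which cancels the Lie derivative. *)
Lemma torsion_difference D X Y Z :
  torsion03 g D X Y Z = difference D X Y Z - difference D Y X Z.
Proof.
have [T0 _] := hLC.
have -> : torsion03 g D X Y Z = torsion03 g D X Y Z - ev02 g (torsion LC X Y) Z.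
  have -> : ev02 g (torsion LC X Y) Z = 0; last by rewrite subr0.
  by rewrite T0 -[0](subrr 0) ev02Dl ev02Nl subrr.
rewrite /torsion03 /difference /torsion !ev02Dl !ev02Nl.
by apply: Cinf_eq => q /=; rewrite !fctE; ring.
Qed.

Lemma covd_metric_difference D X Y Z :
  covd D g X Y Z = - difference D X Y Z - difference D X Z Y.
Proof.
have [_ m0] := hLC.
have -> : covd D g X Y Z = covd D g X Y Z - covd LC g X Y Z by rewrite m0 subr0.
rewrite /covd (gC Y (D X Z)) (gC Y (LC X Z)) (ev02E D X Y) (ev02E D X Z).
by apply: Cinf_eq => q /=; rewrite !fctE; ring.
Qed.

Lemma covd_skew_difference D X Y Z :
  covd D F X Y Z = covd LC F X Y Z + difference D X Y (ev11 A Z)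
    - difference D X Z (ev11 A Y).
Proof.
rewrite /covd (FN Y (D X Z)) (FN Y (LC X Z)) !(skew_metric_apply (_ X _)).
rewrite (ev02E D X Y) (ev02E D X Z).
by apply: Cinf_eq => q /=; rewrite !fctE; ring.
Qed.

(** The Koszul combination of torsion and derivative of the metric leaves a
    single copy of the difference tensor. *)
Lemma connection_formula D :
  conn_given_by g LC (torsion03 g D) (covd D g) D.
Proof.
move=> X Y Z; rewrite /conn_rhs !torsion_difference !covd_metric_difference ev02E.
apply: Cinf_eq => q; rewrite /= !fctE /=.
by rewrite /GRing.scale/=; lra.
Qed.

Lemma conn_given_by_eq T Q D D' :
  conn_given_by g LC T Q D -> conn_given_by g LC T Q D' -> D = D'.
Proof.
move=> gD gD'; apply: connection_eq => X Y; apply: nondegenerate_vfield gnd _ => Z.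
by rewrite gD gD'.
Qed.

Lemma connection_formula_of T Q D :
  (forall X Y Z, torsion03 g D X Y Z = T X Y Z) ->
  (forall X Y Z, covd D g X Y Z = Q X Y Z) -> conn_given_by g LC T Q D.
Proof.
move=> DT DQ X Y Z; rewrite connection_formula /conn_rhs.
by rewrite !DT !DQ.
Qed.

Lemma covd_skew_formula D X Y Z :
  covd D F X Y Z = nablaF_rhs F A LC (torsion03 g D) (covd D g) X Y Z.
Proof.
rewrite /nablaF_rhs !torsion_difference !covd_metric_difference covd_skew_difference.
apply: Cinf_eq => q; rewrite /= !fctE /=.
by rewrite /GRing.scale/=; lra.
Qed.

(** In the cyclic sum of the definition of the covariant derivative of [F] the
    terms pair off as D U V - D V U by skew-symmetry, leaving torsion and
    bracket. *)
Lemma dext_formula D X Y Z (T := torsion03 g D) (P := covd D F) :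
  dext F X Y Z = - T X Y (ev11 A Z) - T Y Z (ev11 A X) - T Z X (ev11 A Y)
    + P X Y Z + P Y Z X + P Z X Y.
Proof.
have TF U V W : T U V (ev11 A W) =
    - (ev02 F (D U V) W - ev02 F (D V U) W - ev02 F (bracket U V) W).
  by rewrite /T /torsion03 -[LHS]opprK -skew_metric_apply /torsion !ev02Dl !ev02Nl.
rewrite !TF /P /covd /dext (FN Y (D X Z)) (FN Z (D Y X)) (FN X (D Z Y)).
by apply: Cinf_eq => q /=; rewrite !fctE; ring.
Qed.

(** The connection with prescribed torsion [T] and derivative [Q] of the metric:
    its difference from [LC] is the metric dual of the form [om X Y]. *)
Section Prescribed.
Variables (T Q : tensor03 M).
Hypothesis TN : forall X Y Z, ev03 T X Y Z = - ev03 T Y X Z.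
Hypothesis QC : forall X Y Z, ev03 Q X Y Z = ev03 Q X Z Y.

Let om X Y q (w : tangent q) : R :=
  2^-1 * (T q (X q) (Y q) w + T q w (X q) (Y q) - T q (Y q) w (X q))
  - 2^-1 * (Q q (X q) (Y q) w + Q q (Y q) w (X q) - Q q w (Y q) (X q)).

Fact prescribed_difference X Y : exists S : vfield M,
  forall q w, g q (S q) w = om X Y w.
Proof.
apply: metric_dual => // [q a u v|Z].
  rewrite /om !(tensor03_linear1 T, tensor03_linear2 T, tensor03_linear3 T,
    tensor03_linear1 Q, tensor03_linear2 Q, tensor03_linear3 Q); ring.
exact: Cinf_smooth (2^-1 *: (ev03 T X Y Z + ev03 T Z X Y - ev03 T Y Z X)
  - 2^-1 *: (ev03 Q X Y Z + ev03 Q Y Z X - ev03 Q Z Y X)).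
Qed.

Let S X Y : vfield M := sval (cid (prescribed_difference X Y)).

Let SE X Y Z : ev02 g (S X Y) Z =
  2^-1 *: (ev03 T X Y Z + ev03 T Z X Y - ev03 T Y Z X)
  - 2^-1 *: (ev03 Q X Y Z + ev03 Q Y Z X - ev03 Q Z Y X).
Proof. by apply: Cinf_eq => q; rewrite /S; case: cid => s /= ->. Qed.

Let SE_at X Y q w : g q (S X Y q) w = om X Y w.
Proof. by rewrite /S; case: cid => s /= ->. Qed.

Let Sl a X X' Y : S (a *: X + X') Y = a *: S X Y + S X' Y.
Proof.
apply: nondegenerate_vfield gnd _ => Z; apply: Cinf_eq => q.
rewrite /= tensor02D tensor02Z !SE_at /om /=.
rewrite !(tensor03_linear1 T, tensor03_linear2 T, tensor03_linear3 T,
    tensor03_linear1 Q, tensor03_linear2 Q, tensor03_linear3 Q); ring.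
Qed.

Let Sr a X Y Y' : S X (a *: Y + Y') = a *: S X Y + S X Y'.
Proof.
apply: nondegenerate_vfield gnd _ => Z; apply: Cinf_eq => q.
rewrite /= tensor02D tensor02Z !SE_at /om /=.
rewrite !(tensor03_linear1 T, tensor03_linear2 T, tensor03_linear3 T,
    tensor03_linear1 Q, tensor03_linear2 Q, tensor03_linear3 Q); ring.
Qed.

Let S0 X : S X 0 = 0.
Proof.
have := Sr 1 X 0 0; rewrite !scale1r addr0 => /eqP.
by rewrite -subr_eq0 opprD addNKr oppr_eq0 => /eqP.
Qed.

Let nab X Y : vfield M := LC X Y + S X Y.

Fact nab_linearl Y : linear (fun X => nab X Y).
Proof.
by move=> a X X'; rewrite /nab (nabla_linearl LC Y) Sl scalerDr addrACA.
Qed.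

Fact nab_additive X Y Z : nab X (Y + Z) = nab X Y + nab X Z.
Proof.
have SD : S X (Y + Z) = S X Y + S X Z by have := Sr 1 X Y Z; rewrite !scale1r.
by rewrite /nab nabla_additive SD addrACA.
Qed.

Fact nab_leibniz X (f : Cinf M) Y : nab X (f *: Y) = lie X f *: Y + f *: nab X Y.
Proof.
have SZ : S X (f *: Y) = f *: S X Y by have := Sr f X Y 0; rewrite S0 !addr0.
by rewrite /nab nabla_leibniz SZ scalerDr addrA.
Qed.

Definition prescribed_connection : connection M :=
  Connection nab_linearl nab_additive nab_leibniz.

Let contE X Y Z : difference prescribed_connection X Y Z =
  2^-1 *: (ev03 T X Y Z + ev03 T Z X Y - ev03 T Y Z X)
  - 2^-1 *: (ev03 Q X Y Z + ev03 Q Y Z X - ev03 Q Z Y X).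
Proof. by rewrite -SE /difference /= /nab addrC addKr. Qed.

Lemma prescribed_torsion X Y Z :
  torsion03 g prescribed_connection X Y Z = ev03 T X Y Z.
Proof.
rewrite torsion_difference !contE [ev03 T Y X Z]TN [ev03 T Z Y X]TN [ev03 T X Z Y]TN.
rewrite [ev03 Q X Z Y]QC [ev03 Q Y Z X]QC [ev03 Q Z Y X]QC.
apply: Cinf_eq => q; rewrite /= !fctE /=.
by rewrite /GRing.scale/=; lra.
Qed.

Lemma prescribed_covd X Y Z :
  covd prescribed_connection g X Y Z = ev03 Q X Y Z.
Proof.
rewrite covd_metric_difference !contE [ev03 T Y X Z]TN [ev03 T Z Y X]TN [ev03 T X Z Y]TN.
rewrite [ev03 Q X Z Y]QC [ev03 Q Y Z X]QC [ev03 Q Z Y X]QC.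
apply: Cinf_eq => q; rewrite /= !fctE /=.
by rewrite /GRing.scale/=; lra.
Qed.

End Prescribed.

End ConnectionAlgebra.

Theorem theorem2p2 (R : realType) (n : nat) (M : manifold R n)
  (G : tensor02 M) (A : tensor11 M) (LC : connection M)
  (g := sym_part G) (F := skew_part G)
  (hG : generalized_riemannian G)
  (hA : forall X Y : vfield M, ev02 F X Y = ev02 g (ev11 A X) Y)
  (hLC : levi_civita g LC) :
  (forall D : connection M,
     let T := torsion03 g D in let Q := covd D g in let P := covd D F in
     [/\ unique (conn_given_by g LC T Q) D,
         (forall D' : connection M,
            (forall X Y, torsion D' X Y = torsion D X Y) ->
            (forall X Y Z, covd D' g X Y Z = Q X Y Z) -> D' = D),
         (forall X Y Z, P X Y Z = nablaF_rhs F A LC T Q X Y Z) &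
         (forall X Y Z, dext F X Y Z =
            - T X Y (ev11 A Z) - T Y Z (ev11 A X) - T Z X (ev11 A Y)
            + P X Y Z + P Y Z X + P Z X Y)])
  /\
  (forall T Q P : tensor03 M,
     (forall X Y Z, ev03 T X Y Z = - ev03 T Y X Z) ->
     (forall X Y Z, ev03 Q X Y Z = ev03 Q X Z Y) ->
     (forall X Y Z, ev03 P X Y Z = - ev03 P X Z Y) ->
     (forall X Y Z, ev03 P X Y Z = nablaF_rhs F A LC (ev03 T) (ev03 Q) X Y Z) ->
     exists D : connection M,
       unique (fun D' : connection M =>
         [/\ (forall X Y Z, torsion03 g D' X Y Z = ev03 T X Y Z),
             (forall X Y Z, covd D' g X Y Z = ev03 Q X Y Z) &
             (forall X Y Z, covd D' F X Y Z = ev03 P X Y Z)]) D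
       /\ unique (conn_given_by g LC (ev03 T) (ev03 Q)) D).
Proof.
have gC (X Y : vfield M) : ev02 g X Y = ev02 g Y X.
  by apply: Cinf_eq => q; rewrite /= addrC.
have FN (X Y : vfield M) : ev02 F X Y = - ev02 F Y X.
  by apply: Cinf_eq => q; rewrite /= !fctE -mulrN opprB.
have gnd : nondegenerate g := hG.
split=> [D T Q P|T Q P TN QC PN hP].
  split=> [|D' DT DQ|X Y Z|X Y Z].
  - split; first exact: connection_formula.
    by move=> D' gD'; apply: (conn_given_by_eq gnd _ gD'); exact: connection_formula.
  - apply: (@conn_given_by_eq _ _ _ g LC gnd T Q).
      by apply: connection_formula_of => // X Y Z; rewrite /torsion03 DT.
    exact: connection_formula.
  - exact: covd_skew_formula.
  - exact: dext_formula.
pose D := prescribed_connection LC gnd T Q.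
have DT := prescribed_torsion gnd hLC TN QC.
have DQ := prescribed_covd gC gnd hLC TN QC.
have gD : conn_given_by g LC (ev03 T) (ev03 Q) D by exact: connection_formula_of.
exists D; split; split=> //.
- split=> // X Y Z; rewrite (covd_skew_formula gC FN hA hLC) hP /nablaF_rhs.
  by rewrite !DT !DQ.
- move=> D' [D'T D'Q _]; apply: (conn_given_by_eq gnd gD).
  exact: connection_formula_of.
- by move=> D' gD'; exact: (conn_given_by_eq gnd gD gD').
Qed.
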